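(* Let $W$ be a cuboid or a bounded domain in $\mathbb R^{N-1}$ of class $C^{0,1}$, let $Y=\left(-\frac12,\frac12\right)^{N-1}$, and let $b\in C^{0,1}(\mathbb R^{N-1})$ be a $Y$-periodic function with $b\ge0$ in $\mathbb R^{N-1}$ and $\mathcal H^{N-1}(\{x'\in\mathbb R^{N-1}:|\nabla_{x'}b(x')|=0\})=0$. For $\varepsilon>0$ let $g_\varepsilon(x')=\varepsilon^\alpha b(x'/\varepsilon)$ for $x'\in W$ and $\Omega_\varepsilon=\{(x',x_N):x'\in W,\ -1<x_N<g_\varepsilon(x')\}$, and let $\Omega_0=\Omega=W\times(-1,0)$. Then: (i) if $\alpha>1$, then $$\lim_{\varepsilon\to0}\|g_\varepsilon\|_{L^\infty(W)}=0,\qquad\left\|\frac{\partial g_\varepsilon}{\partial x_k}\right\|_{L^\infty(W)}=O(1)\ \text{as }\varepsilon\to0\ \text{for every }k\in\{1,\dots,N-1\},$$ and $\mathrm{Per}(\Omega_\varepsilon)\to\mathrm{Per}(\Omega)$ as $\varepsilon\to0$; (ii) if $\alpha=1$, then $$\lim_{\varepsilon\to0}\|g_\varepsilon\|_{L^\infty(W)}=0,\qquad\left\|\frac{\partial g_\varepsilon}{\partial x_k}\right\|_{L^\infty(W)}=O(1)\ \text{as }\varepsilon\to0\ \text{for every }k\in\{1,\dots,N-1\},$$ and $\sqrt{1+|\nabla_{x'}g_\varepsilon|^2}\rightharpoonup\int_Y\sqrt{1+|\nabla_{x'}b(y')|^2}\,dy'$ (a constant function) weakly in $L^1(W)$ as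 $\varepsilon\to0$; (iii) if $0<\alpha<1$, then $$\lim_{\varepsilon\to0}\|g_\varepsilon\|_{L^\infty(W)}=0,\qquad\lim_{\varepsilon\to0}\mathcal H^{N-1}\left(\left\{x'\in W:\sqrt{1+|\nabla_{x'}g_\varepsilon(x')|^2}\le t\right\}\right)=0\ \text{for every }t>0.$$
   Context: $N\ge2$; $x=(x',x_N)$ with $x'\in\mathbb R^{N-1}$; $\mathcal H^{N-1}$ is the $(N-1)$-dimensional Lebesgue measure; $\mathrm{Per}(\Omega)$ is the perimeter of $\Omega$, i.e. the $(N-1)$-dimensional measure of $\partial\Omega$. $Y$-periodic means $1$-periodic in each of the $N-1$ variables. $\nabla_{x'}b(y')$ denotes the gradient of $b$ at $y'$. *)

(* Defs.v *)
From HB Require Import structures.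
From mathcomp Require Import all_boot all_order all_algebra.
From mathcomp Require Import all_classical all_reals all_analysis.

Set Implicit Arguments.
Unset Strict Implicit.
Unset Printing Implicit Defensive.

Import Order.TTheory GRing.Theory Num.Theory.
Import numFieldNormedType.Exports.

Local Open Scope classical_set_scope.
Local Open Scope ring_scope.

(* The sigma-algebra on R^n generated by the coordinates, i.e. the Borel one. *)
Definition rV_display : measure_display. Proof. exact. Qed.

Section measurable_rV.
Context {R : realType} (n : nat).

Let coords : 'I_n -> 'rV[R]_n -> measurableTypeR R := fun i x => x ord0 i.

Let rV_set0 : g_sigma_preimage coords set0.
Proof. exact: sigma_algebra0. Qed.

Let rV_setC A : g_sigma_preimage coords A -> g_sigma_preimage coords (~` A).
Proof. exact: sigma_algebraC. Qed.

Let rV_bigcup (F : _^nat) : (forall i, g_sigma_preimage coords (F i)) ->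
  g_sigma_preimage coords (\bigcup_i (F i)).
Proof. exact: sigma_algebra_bigcup. Qed.

HB.instance Definition _ := @isMeasurable.Build rV_display
  'rV[R]_n (g_sigma_preimage coords) rV_set0 rV_setC rV_bigcup.

End measurable_rV.

Lemma measurable_coord (R : realType) n (i : 'I_n) :
  measurable_fun [set: 'rV[R]_n] (fun x : 'rV[R]_n => x ord0 i).
Proof.
move=> _ Y mY; rewrite setTI; apply: sub_sigma_algebra => /=.
rewrite -bigcup_seq/=; exists i => /=; first by rewrite mem_index_enum.
by exists Y => //; rewrite setTI.
Qed.

Lemma measurable_fun_rVP (R : realType) n d (T : measurableType d)
    (f : T -> 'rV[R]_n) :
  measurable_fun [set: T] f <->
  forall i, measurable_fun [set: T] (fun x => f x ord0 i).
Proof.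
split=> [mf i|mf].
  exact: (measurableT_comp (measurable_coord i) mf).
move=> _ A mA; rewrite setTI.
pose S := [set B : set 'rV[R]_n | measurable (f @^-1` B)].
suff : measurable `<=` S by apply.
apply: smallest_sub.
  split.
  - by rewrite /S/= preimage_set0.
  - by move=> B; rewrite /S/= setTD -preimage_setC; exact: measurableC.
  - by move=> F mF; rewrite /S/= preimage_bigcup; exact: bigcupT_measurable.
rewrite -bigcup_seq => B [i _ [C mC <-]]; rewrite /S/= setTI -comp_preimage.
by rewrite -[X in measurable X]setTI; exact: mf.
Qed.

Definition rVcons (R : realType) n (p : R * 'rV[R]_n) : 'rV[R]_n.+1 :=
  row_mx p.1%:M p.2.

Lemma rVcons0 (R : realType) n (p : R * 'rV[R]_n) :
  rVcons p ord0 ord0 = p.1.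
Proof.
have -> : (ord0 : 'I_n.+1) = lshift n (ord0 : 'I_1) by exact: val_inj.
by rewrite [LHS](row_mxEl p.1%:M p.2) mxE eqxx.
Qed.

Lemma rVconsS (R : realType) n (p : R * 'rV[R]_n) (i : 'I_n) :
  rVcons p ord0 (lift ord0 i) = p.2 ord0 i.
Proof.
have -> : lift ord0 i = rshift 1 i by exact: val_inj.
exact: (row_mxEr p.1%:M p.2).
Qed.

Lemma measurable_rVcons (R : realType) n :
  measurable_fun [set: measurableTypeR R * 'rV[R]_n] (@rVcons R n).
Proof.
apply/measurable_fun_rVP => i; case: (unliftP ord0 i) => [j|] ->.
  under eq_fun do rewrite rVconsS.
  exact: (measurableT_comp (measurable_coord j)).
by under eq_fun do rewrite rVcons0; exact: measurable_fst.
Qed.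

Section lebesgue_cons.
Context (R : realType) (n : nat).
Variable m : {sigma_finite_measure set 'rV[R]_n -> \bar R}.
Local Open Scope ereal_scope.

Definition lebesgue_cons : set 'rV[R]_n.+1 -> \bar R :=
  pushforward (@lebesgue_measure R \x m) (@rVcons R n).

Let pm : {measure set 'rV[R]_n.+1 -> \bar R} :=
  measure_function_pushforward__canonical__measure_function_Measure
    (@lebesgue_measure R \x m) (@measurable_rVcons R n).

HB.instance Definition _ := isMeasure.Build _ _ _ lebesgue_cons
  (measure0 pm) (measure_ge0 pm) (@measure_semi_sigma_additive _ _ _ pm).

Let sigma_finite_lebesgue_cons : sigma_finite setT lebesgue_cons.
Proof.
have /sigma_finiteP[F [TF ndF Foo]] := sigma_finiteT (@lebesgue_measure R).
have /sigma_finiteP[G [TG ndG Goo]] := sigma_finiteT m.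
pose g (x : 'rV[R]_n.+1) : measurableTypeR R * 'rV[R]_n :=
  (x ord0 ord0, \row_j x ord0 (lift ord0 j)).
have mg : measurable_fun [set: 'rV[R]_n.+1] g.
  apply: measurable_fun_pair; first exact: measurable_coord.
  apply/measurable_fun_rVP => i; under eq_fun do rewrite mxE.
  exact: measurable_coord.
have gK p : g (rVcons p) = p.
  rewrite /g rVcons0 [RHS]surjective_pairing; congr pair.
  by apply/rowP => j; rewrite mxE rVconsS.
exists (fun k => g @^-1` (F k `*` G k)).
  apply/esym; rewrite -subTset => x _.
  have [k _ Fk] : (\bigcup_k F k) (g x).1 by rewrite -TF.
  have [l _ Gl] : (\bigcup_k G k) (g x).2 by rewrite -TG.
  exists (maxn k l) => //; split.
  - by move: Fk; exact/subsetPset/ndF/leq_maxl.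
  - by move: Gl; exact/subsetPset/ndG/leq_maxr.
move=> k; have [mF Fk] := Foo k; have [mG Gk] := Goo k; split.
  by rewrite -[X in measurable X]setTI; apply: mg => //; exact: measurableX.
rewrite /lebesgue_cons /pushforward.
suff -> : @rVcons R n @^-1` (g @^-1` (F k `*` G k)) = F k `*` G k.
  by rewrite product_measure1E// lte_mul_pinfty// ge0_fin_numE.
by apply/funext => p; rewrite /preimage/mkset gK.
Qed.

HB.instance Definition _ := Measure_isSigmaFinite.Build _ _ _ lebesgue_cons
  sigma_finite_lebesgue_cons.

End lebesgue_cons.

(* n-dimensional Lebesgue measure as the n-fold product of the one-dimensional
   one, starting from the unit mass on the one-point space R^0; lebesgue_rV_box
   gives its value on boxes, which characterizes it. *)
Fixpoint lebesgue_rV (R : realType) n :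
    {sigma_finite_measure set 'rV[R]_n -> \bar R} :=
  match n with
  | 0%N => [the {sigma_finite_measure set 'rV[R]_0 -> \bar R} of
               dirac (0 : 'rV[R]_0)]
  | n'.+1 => [the {sigma_finite_measure set 'rV[R]_n'.+1 -> \bar R} of
               lebesgue_cons (@lebesgue_rV R n')]
  end.
Arguments lebesgue_rV : clear implicits.

Definition open_box (R : realType) n (a c : 'rV[R]_n) : set 'rV[R]_n :=
  [set x | forall i, a ord0 i < x ord0 i < c ord0 i].

Lemma measurable_open_box (R : realType) n (a c : 'rV[R]_n) :
  measurable (open_box a c).
Proof.
rewrite (_ : open_box a c = \bigcap_(i in [set: 'I_n])
    ((fun x : 'rV[R]_n => x ord0 i) @^-1` `]a ord0 i, c ord0 i[%classic)).
  apply: fin_bigcap_measurable => //= i _.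
  rewrite -[X in measurable X]setTI; apply: measurable_coord => //.
by apply/seteqP; split=> x xac i; have := xac i; rewrite /= in_itv//=; exact.
Qed.

Lemma lebesgue_rV_box (R : realType) n (a c : 'rV[R]_n) :
  (forall i, a ord0 i <= c ord0 i) ->
  lebesgue_rV R n (open_box a c) = (\prod_i (c ord0 i - a ord0 i))%:E.
Proof.
elim: n a c => [|n IH] a c ac.
  by rewrite big_ord0 /= diracE mem_set// => -[].
pose tl (x : 'rV[R]_n.+1) := \row_j x ord0 (lift ord0 j).
rewrite /= /lebesgue_cons /pushforward.
rewrite (_ : _ @^-1` _ =
    `]a ord0 ord0, c ord0 ord0[%classic `*` open_box (tl a) (tl c)).
  rewrite product_measure1E//; last exact: measurable_open_box.
  rewrite IH; last by move=> i; rewrite !mxE.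
  rewrite [X in (X * _)%E](lebesgue_measure_itv `]a ord0 ord0, c ord0 ord0[)/=.
  rewrite lte_fin big_ord_recl.
  rewrite (eq_bigr (fun i => c ord0 (lift ord0 i) - a ord0 (lift ord0 i)));
    last by move=> i _; rewrite !mxE.
  have [_|] := ltP; first by rewrite -EFinB -EFinM.
  move=> ca; have -> : c ord0 ord0 = a ord0 ord0.
    by apply/eqP; rewrite eq_le ca ac.
  by rewrite subrr mul0r mul0e.
apply/seteqP; split=> p /=.
  move=> H; split; first by have := H ord0; rewrite rVcons0 in_itv.
  by move=> i; have := H (lift ord0 i); rewrite rVconsS !mxE.
move=> [p1 p2] i; case: (unliftP ord0 i) => [j|] ->.
  by rewrite rVconsS; have := p2 j; rewrite !mxE.
by rewrite rVcons0; move: p1; rewrite in_itv.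
Qed.

(* The library's norm on 'rV[R]_n is the sup norm. *)
Definition eucl_norm (R : realType) n (x : 'rV[R]_n) : R :=
  Num.sqrt (\sum_i x ord0 i ^+ 2).

Definition partial (R : realType) n (k : 'I_n) (f : 'rV[R]_n -> R) :
    'rV[R]_n -> R :=
  'D_(delta_mx ord0 k) f.

Definition grad (R : realType) n (f : 'rV[R]_n -> R) (x : 'rV[R]_n) :
    'rV[R]_n :=
  \row_k partial k f x.

Definition area_density (R : realType) n (f : 'rV[R]_n -> R)
    (x : 'rV[R]_n) : R :=
  Num.sqrt (1 + eucl_norm (grad f x) ^+ 2).

(* Extending by 0 outside D does not affect the essential supremum of |f|
   over D. *)
Definition Linfty_norm (R : realType) n (D : set 'rV[R]_n)
    (f : 'rV[R]_n -> R) : \bar R :=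
  'N[lebesgue_rV R n]_+oo [EFin \o (f \_ D)].

Definition L1_weak_cvg (R : realType) n (D : set 'rV[R]_n)
    (f : R -> 'rV[R]_n -> R) (l : 'rV[R]_n -> R) : Prop :=
  let mu := lebesgue_rV R n in
  [/\ forall e, 0 < e -> mu.-integrable D (EFin \o f e),
      mu.-integrable D (EFin \o l) &
      forall phi : 'rV[R]_n -> R,
        measurable_fun D phi -> (Linfty_norm D phi < +oo)%E ->
        (\int[mu]_(x in D) (f e x * phi x)%:E)%E @[e --> 0^'+] -->
        (\int[mu]_(x in D) (l x * phi x)%:E)%E].

Section hausdorff.
Context (R : realType) (m : nat).
Implicit Types A : set 'rV[R]_m.
Local Open Scope ereal_scope.

Definition diameter A : \bar R :=
  ereal_sup (0 |` [set (eucl_norm (x - y)%R)%:E | x in A & y in A]).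

Definition hausdorff_pre (s : nat) (d : R) A : \bar R :=
  ereal_inf [set \sum_(k <oo) (lebesgue_rV R s [set x | eucl_norm x < 1]%R *
                               (2^-1%:E * diameter (F k)) ^+ s)
            | F in [set F : (set 'rV[R]_m)^nat |
                A `<=` \bigcup_k F k /\ forall k, diameter (F k) <= d%:E]].

(* s-dimensional Hausdorff measure for an integer s > 0, normalized by the
   volume of the unit ball of R^s so that it is Lebesgue measure when m = s. *)
Definition hausdorff (s : nat) A : \bar R :=
  ereal_sup [set hausdorff_pre s d A | d in [set d | (0 < d)%R]].

End hausdorff.

Definition boundary (T : topologicalType) (A : set T) : set T :=
  closure A `\` interior A.

Definition perimeter (R : realType) n (A : set 'rV[R]_(n + 1)) : \bar R :=
  hausdorff n (boundary A).

Definition cuboid (R : realType) n (W : set 'rV[R]_n) : Prop :=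
  exists a c : 'rV[R]_n,
    (forall i, a ord0 i < c ord0 i) /\ W = open_box a c.

(* Near each boundary point, in suitable orthonormal coordinates y = x *m Q,
   W is the strict epigraph of a Lipschitz function of the n - 1 coordinates
   other than y_k. *)
Definition lipschitz_domain (R : realType) n (W : set 'rV[R]_n) : Prop :=
  [/\ open W, connected W, W !=set0, bounded_set W &
      forall p, boundary W p ->
        exists (Q : 'M[R]_n) (k : 'I_n) (h : 'rV[R]_n.-1 -> R),
          [/\ Q *m Q^T = 1%:M, lipschitz h &
              \forall x \near p,
                W x <-> h (col' k (x *m Q)) < (x *m Q) ord0 k]].

Definition cell_periodic (R : realType) n (f : 'rV[R]_n -> R) : Prop :=
  forall (k : 'I_n) x, f (x + delta_mx ord0 k) = f x.

Definition unit_cell (R : realType) n : set 'rV[R]_n :=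
  open_box (const_mx (- 2^-1)) (const_mx 2^-1).
Arguments unit_cell : clear implicits.

Definition subgraph (R : realType) n (W : set 'rV[R]_n) (g : 'rV[R]_n -> R) :
    set 'rV[R]_(n + 1) :=
  [set x | W (lsubmx x) /\ -1 < rsubmx x ord0 ord0 < g (lsubmx x)].

Definition oscillating (R : realType) n (alpha : R) (b : 'rV[R]_n -> R)
    (e : R) (x : 'rV[R]_n) : R :=
  e `^ alpha * b (e^-1 *: x).

(* Main.v *)
(* Boundary: the subgraph of g is the image of W x (-1, 0) under
   (x', t) |-> (x', t + (1 + t) g(x')), which is bi-Lipschitz on -1 <= t <= 0 with
   constants 1 + delta and 1 - 2 delta, where delta = sup g + Lip g. Hence the two
   perimeters differ by factors (1 + delta)^n and (1 - 2 delta)^n, and for alpha > 1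
   delta tends to 0 with e; no finiteness of the perimeter is needed.

   Oscillation: for a 1-periodic G >= 0 and a set B, translating by e s gives
     \int_B G(x/e) dx = \int_(B - e s) G(x/e + s) dx   for every s in the cell Y.
   Averaging over s and exchanging integrals replaces G(x/e + s) by the mean of G over
   Y, so \int_B G(x/e) dx lies between the mean times the measures of an inner and an
   outer e-neighbourhood of B. With G the indicator of {|grad b| <= delta} this gives
   (iii), since |grad g_e(x)| = e^(alpha - 1) |grad b(x/e)|. With G the area density
   and B a box it gives the convergence in (ii) tested on boxes; boxes form a
   pi-system, so it extends to measurable sets by Dynkin's lemma and then to L^1 by
   density of simple functions, the oscillating family being uniformly bounded. *)
Require Import Defs.
From HB Require Import structures.
From mathcomp Require Import all_boot all_order all_algebra.
From mathcomp Require Import all_classical all_reals all_analysis.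
From mathcomp Require Import measurable_realfun ess_sup_inf.
From mathcomp Require Import lra ring.

Set Implicit Arguments.
Unset Strict Implicit.
Unset Printing Implicit Defensive.

Import Order.TTheory GRing.Theory Num.Theory.
Import numFieldNormedType.Exports.

Local Open Scope classical_set_scope.
Local Open Scope ring_scope.

(** * The Borel sigma-algebra of row vectors *)

Lemma exists_invS_lt (R : archiRealFieldType) (e : R) :
  0 < e -> exists k, k.+1%:R^-1 < e.
Proof.
move=> e0; exists (Num.Def.archi_bound e^-1); rewrite invf_plt ?posrE//.
by rewrite (lt_trans (archi_boundP _)) ?ltr_nat// invr_ge0 ltW.
Qed.

Section borel_rV.
Context {R : realType} {n : nat}.
Implicit Types (U : set 'rV[R]_n) (u x y : 'rV[R]_n).

Lemma nbhs_coord_ball U x : nbhs x U ->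
  exists2 e : R, 0 < e &
    forall y, (forall i, `|x ord0 i - y ord0 i| < e) -> U y.
Proof.
move=> /nbhs_ballP[e e0 eU]; exists e => // y xy; apply: eU; split => // i j.
by rewrite (ord1 i); exact: xy.
Qed.

(** The sigma-algebra is generated by the coordinates, so [U] has to be written as a countable union
    of boxes: those with rational centre and half-width [1/(k+1)] that lie inside [U]. *)
Lemma open_measurable_rV U : open U -> measurable U.
Proof.
move=> oU; pose c (kq : nat * 'rV[rat]_n) (s : R) : 'rV[R]_n :=
  \row_i (ratr (kq.2 ord0 i) + s * kq.1.+1%:R^-1).
pose B kq := open_box (c kq (-1)) (c kq 1).
rewrite (_ : U = \bigcup_(kq in [set: nat * 'rV[rat]_n])
    (if `[< B kq `<=` U >] then B kq else set0)).
  apply: countable_bigcupT_measurable => [|kq]; first exact: countableP.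
  by case: ifP => // _; exact: measurable_open_box.
apply/seteqP; split=> [x Ux|x [kq _]]; last by case: asboolP => // BU /BU.
have [e e0 eU] := nbhs_coord_ball (open_nbhs_nbhs (conj oU Ux)).
(* With half-width [d < e/2] and a rational centre within [d] of [x], every point of the box is
   within [2d < e] of [x]. *)
have [k ke] := exists_invS_lt (divr_gt0 e0 (ltr0n R 2)).
have k0 : 0 < k.+1%:R^-1 :> R by rewrite invr_gt0.
set d := k.+1%:R^-1 in ke k0; rewrite ltr_pdivlMr// in ke.
have q_ i : {q : rat | `|x ord0 i - ratr q| < d}.
  apply: cid; have /rat_in_itvoo[q] : x ord0 i - d < x ord0 i by lra.
  rewrite in_itv/= => /andP[? ?]; exists q; rewrite ltr_norml.
  by apply/andP; split; lra.
exists (k, \row_i sval (q_ i)) => //; case: asboolP => [_|[]].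
  move=> i; rewrite !mxE/= -/d; case: (q_ i) => q /=.
  by rewrite ltr_norml => /andP[? ?]; apply/andP; split; lra.
move=> y xy; apply: eU => i; move: (xy i); rewrite !mxE/= -/d.
case: (q_ i) => q /=; rewrite !ltr_norml => /andP[? ?] /andP[? ?].
by apply/andP; split; lra.
Qed.

Lemma closed_measurable_rV U : closed U -> measurable U.
Proof.
move=> cU; rewrite -(setCK U); apply: measurableC; apply: open_measurable_rV.
exact: closed_openC.
Qed.

Lemma continuous_measurable_rV (f : 'rV[R]_n -> R) :
  continuous f -> measurable_fun [set: 'rV[R]_n] f.
Proof.
move=> cf; apply: (measurability _ (RGenOInfty.measurableE R)) => //.
move=> _ [_ [r ->] <-]; rewrite setTI; apply: open_measurable_rV.
by move/continuousP : cf; apply; exact: interval_open.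
Qed.

Lemma measurable_rV_shift u : measurable_fun setT (fun x => x + u).
Proof.
apply/measurable_fun_rVP => i; under eq_fun do rewrite mxE.
by apply: measurable_funD => //; exact: measurable_coord.
Qed.

Lemma measurable_rV_scale (a : R) : measurable_fun setT (fun x => a *: x).
Proof.
apply/measurable_fun_rVP => i; under eq_fun do rewrite mxE.
by apply: measurable_funM => //; exact: measurable_coord.
Qed.

Definition boxes : set (set 'rV[R]_n) := [set B | exists a c, B = open_box a c].

Lemma setI_closed_boxes : setI_closed boxes.
Proof.
move=> _ _ [a [c ->]] [a' [c' ->]].
exists (\row_i Num.max (a ord0 i) (a' ord0 i)).
exists (\row_i Num.min (c ord0 i) (c' ord0 i)).
apply/seteqP; split=> [x [ac ac'] i|x H].
  by rewrite !mxE gt_max lt_min; move: (ac i) (ac' i) => /andP[-> ->] /andP[-> ->].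
split=> i; move: (H i); rewrite !mxE gt_max lt_min;
  by move=> /andP[/andP[? ?] /andP[? ?]]; apply/andP.
Qed.

Definition cube (k : R) : set 'rV[R]_n := open_box (const_mx (- k)) (const_mx k).

Lemma cube_cover : \bigcup_k cube k%:R = [set: 'rV[R]_n].
Proof.
rewrite -subTset => x _; exists (Num.Def.archi_bound `|x|) => // i.
rewrite !mxE -ltr_norml; apply: le_lt_trans (archi_boundP _) => //.
by rewrite [leRHS]mx_normrE (le_bigmax _ _ (ord0, i)).
Qed.

(** Supplies the generating pi-system for Dynkin's lemma. The half-space [x_i > r] is the union over
    [k] of the boxes with lower corner [r] in coordinate [i] and [-k] elsewhere, and upper corner
    [k]. *)
Lemma measurable_rV_boxes : measurable = <<s boxes >>.
Proof.
apply/seteqP; split; last first.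
  apply: smallest_sub; first exact: sigma_algebra_measurable.
  by move=> _ [a [c ->]]; exact: measurable_open_box.
apply: smallest_sub; first exact: smallest_sigma_algebra.
rewrite -bigcup_seq => _ [i _ [Y mY <-]]; rewrite setTI.
pose pr (x : g_sigma_algebraType boxes) : R := (x : 'rV[R]_n) ord0 i.
suff: measurable_fun [set: g_sigma_algebraType boxes] pr.
  by move=> mpr; rewrite -[X in <<s _ >> X]setTI; exact: mpr.
apply: (measurability _ (RGenOInfty.measurableE R)) => //.
move=> _ [_ [r ->] <-]; rewrite setTI.
rewrite (_ : _ @^-1` _ = \bigcup_(k in setT) (open_box
  (\row_j if j == i then r else - k%:R) (const_mx k%:R) : set 'rV[R]_n)).
  apply: bigcupT_measurable => k; apply: sub_sigma_algebra.
  by eexists; eexists; reflexivity.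
apply/seteqP; split=> [x|x [k _ /(_ i)]]; last first.
  by rewrite /pr !mxE eqxx/= in_itv/= andbT => /andP[].
rewrite /= in_itv/= andbT => rx.
have [k _ xk] : (\bigcup_k cube k%:R) x by rewrite cube_cover.
exists k => // j; move: (xk j); rewrite !mxE; case: eqP => // -> /andP[_ ->].
by rewrite andbT.
Qed.

End borel_rV.

(** * Fubini, translations and periodic functions *)

Section lebesgue_line.
Context {R : realType}.
Local Notation leb := (@lebesgue_measure R).
Local Open Scope ereal_scope.
Implicit Types (f : measurableTypeR R -> \bar R) (u a : R).

Lemma measurable_addr_line u : measurable_fun [set: measurableTypeR R]
  ((fun t => t + u)%R : R -> measurableTypeR R).
Proof. by apply: measurable_funD. Qed.

(** The pushforward by a translation agrees with Lebesgue measure on half-open intervals, hence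
    everywhere by uniqueness. *)
Lemma lebesgue_measure_shift u (A : set (measurableTypeR R)) : measurable A ->
  leb ((fun t => t + u)%R @^-1` A) = leb A.
Proof.
move=> mA.
pose nu : {measure set (measurableTypeR R) -> \bar R} :=
  measure_function_pushforward__canonical__measure_function_Measure
    leb (measurable_addr_line u).
apply/esym; apply: (@lebesgue_measure_unique _ nu) => // _ [[a b]] _ <-.
rewrite /nu /= /pushforward.
have -> : ((fun t => t + u)%R @^-1` `]a, b] = `]a - u, b - u]%classic)%R.
  by apply/seteqP; split=> t /=; rewrite !in_itv/= ltrBlDr lerBrDr.
by rewrite !lebesgue_measure_itv/= !lte_fin ltrD2r -!EFinB opprB addrA subrK.
Qed.

Lemma ge0_integral_shift u f (D : set (measurableTypeR R)) : measurable D ->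
  measurable_fun [set: measurableTypeR R] f -> (forall t, 0 <= f t) ->
  \int[leb]_(t in (fun t => t + u)%R @^-1` D) f (t + u)%R =
  \int[leb]_(t in D) f t.
Proof.
move=> mD mf f0.
rewrite -(@ge0_integral_pushforward _ _ _ _ _ _ (measurable_addr_line u) leb D f)//.
- apply: eq_measure_integral; first exact: measurable_addr_line.
  by move=> m_add A mA _; exact: (lebesgue_measure_shift u mA).
- exact: measurable_funTS.
Qed.

(** [I a] is the integral over the period [[a, a + 1)]. It is constant in [a]: first for moves by at
    most 1, then for integer moves, and a general [u] reduces to its fractional part. *)
Lemma ge0_integral_periodic u f : measurable_fun [set: measurableTypeR R] f ->
  (forall t, 0 <= f t) -> (forall t, f (t + 1)%R = f t) ->
  \int[leb]_(t in `](- 2^-1)%R, (2^-1)%R[%classic) f (t + u)%R =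
  \int[leb]_(t in `](- 2^-1)%R, (2^-1)%R[%classic) f t.
Proof.
move=> mf f0 f1; pose I a := \int[leb]_(t in `[a, (a + 1)%R[%classic) f t.
have mfD D : measurable_fun D f by exact: measurable_funTS.
have split_itv (a b c : R) : (a <= b <= c)%R ->
    \int[leb]_(t in `[a, c[%classic) f t =
    \int[leb]_(t in `[a, b[%classic) f t + \int[leb]_(t in `[b, c[%classic) f t.
  move=> /andP[ab bc]; rewrite -ge0_integral_setU//.
  - by rewrite -itv_bndbnd_setU// bnd_simp.
  - by rewrite disj_set2E; apply/eqP/seteqP; split=> t //= []; rewrite !in_itv/=; lra.
(* Moving the window from [a] to [b] trades [[a, b)] for [[a + 1, b + 1)], where [f] has the same
   integral. *)
have I_loc a b : (a <= b <= a + 1)%R -> I b = I a.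
  move=> ab; rewrite /I (split_itv a b (a + 1))%R//.
  rewrite (split_itv b (a + 1) (b + 1))%R; last first.
    by rewrite lerD2r; move: ab => /andP[-> ->].
  rewrite addeC; congr (_ + _).
  rewrite -(ge0_integral_shift 1 (D := `[(a + 1)%R, (b + 1)%R[%classic))//.
  rewrite (_ : _ @^-1` _ = `[a, b[%classic); last first.
    by apply/seteqP; split=> t /=; rewrite !in_itv/= lerD2r ltrD2r.
  by apply: eq_integral => t _; rewrite f1.
have I_nat a k : I (a + k%:R)%R = I a.
  elim: k => [|k IH]; first by rewrite addr0.
  rewrite -IH; apply: I_loc; rewrite -natr1; apply/andP; split; lra.
have I_int a (z : int) : I (a + z%:~R)%R = I a.
  by case: z => k; [exact: I_nat|rewrite NegzE mulrNz -(I_nat (a - _)%R k.+1) subrK].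
have I_cst a : I (a + u)%R = I a.
  rewrite -(I_int (a + u)%R (- Num.floor u)%R); apply: I_loc.
  have /andP[] := floor_itv u; rewrite intrD mulr1z mulrNz.
  move: (_%:~R : R) => z ? ?; by apply/andP; split; lra.
transitivity (I (- 2^-1 + u)%R); last first.
  have h : (- 2^-1 + 1 = 2^-1 :> R)%R by lra.
  by rewrite I_cst /I h; apply: integral_itv_bndoo; exact: mfD.
have mfu : measurable_fun [set: measurableTypeR R] (fun t : R => f (t + u)%R).
  exact: (measurableT_comp mf (measurable_addr_line u)).
rewrite /I -(ge0_integral_shift u (D := `[(- 2^-1 + u)%R, (- 2^-1 + u + 1)%R[%classic))//.
rewrite [X in _ = \int[_]_(_ in X) _](_ : _ = `[(- 2^-1)%R, (2^-1)%R[%classic).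
  by apply/esym/integral_itv_bndoo/measurable_funTS.
by apply/seteqP; split=> t /=; rewrite !in_itv/= => /andP[? ?]; apply/andP; split; lra.
Qed.

End lebesgue_line.

Section lebesgue_rV_fubini.
Context {R : realType}.
Local Notation mu n := (lebesgue_rV R n).
Local Open Scope ereal_scope.

Lemma ge0_integral_rVcons n (G : 'rV[R]_n.+1 -> \bar R) :
  measurable_fun setT G -> (forall x, 0 <= G x) ->
  \int[mu n.+1]_x G x = \int[lebesgue_measure]_t \int[mu n]_x G (rVcons (t, x)).
Proof.
move=> mG G0.
rewrite [LHS](@ge0_integral_pushforward _ _ _ _ _ _ (@measurable_rVcons R n)
  (lebesgue_measure \x mu n) setT G)// preimage_setT.
rewrite fubini_tonelli1// => [|x]; last exact: G0.
exact: (measurableT_comp mG (@measurable_rVcons R n)).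
Qed.

End lebesgue_rV_fubini.

Lemma measurable_fun_patch d (T : measurableType d) (R : realType) (D : set T)
    (f : T -> \bar R) :
  measurable D -> measurable_fun setT f -> measurable_fun setT (f \_ D).
Proof.
by move=> mD mf; exact: (iffLR (measurable_restrictT f mD) (measurable_funTS mf)).
Qed.

Section lebesgue_rV_periodic.
Context {R : realType}.
Local Notation mu n := (lebesgue_rV R n).
Local Notation icell := (`](- 2^-1)%R, (2^-1)%R[%classic : set (measurableTypeR R)).
Local Open Scope ereal_scope.

Definition rV_tail n (u : 'rV[R]_n.+1) : 'rV[R]_n := \row_i u ord0 (lift ord0 i).

Lemma rVcons_add n (p : R * 'rV[R]_n) (u : 'rV[R]_n.+1) :
  (rVcons p + u)%R = rVcons (p.1 + u ord0 ord0, p.2 + rV_tail u)%R.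
Proof.
apply/rowP => i; rewrite [LHS]mxE; case: (unliftP ord0 i) => [j|] ->.
  by rewrite !rVconsS !mxE.
by rewrite !rVcons0.
Qed.

Lemma rVcons_delta0 n (t : R) (x : 'rV[R]_n) :
  rVcons ((t + 1)%R, x) = (rVcons (t, x) + delta_mx ord0 ord0)%R.
Proof.
rewrite rVcons_add/= mxE eqxx/=; congr (rVcons (_, _)).
by apply/rowP => i; rewrite !mxE/= addr0.
Qed.

Lemma rVcons_deltaS n (t : R) (x : 'rV[R]_n) k :
  rVcons (t, (x + delta_mx ord0 k)%R) =
  (rVcons (t, x) + delta_mx ord0 (lift ord0 k))%R.
Proof.
rewrite rVcons_add/= mxE/= addr0; congr (rVcons (_, _)).
by apply/rowP => i; rewrite !mxE/= (inj_eq lift_inj).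
Qed.

Lemma measurable_fun_slice n (G : 'rV[R]_n.+1 -> \bar R) t :
  measurable_fun setT G -> measurable_fun setT (fun x => G (rVcons (t, x))).
Proof.
move=> mG; apply: (measurableT_comp mG).
exact: (measurableT_comp (@measurable_rVcons R n) (pair1_measurable _)).
Qed.

Lemma measurable_fun_integral_slice n (G : 'rV[R]_n.+1 -> \bar R) :
  measurable_fun setT G -> (forall x, 0 <= G x) ->
  measurable_fun [set: measurableTypeR R]
    (fun t : measurableTypeR R => \int[mu n]_x G (rVcons (t, x))).
Proof.
move=> mG G0; apply: (@measurable_fun_fubini_tonelli_F _ _ _ _ _ (mu n)
  (G \o @rVcons R n)) => [|x]; last exact: G0.
exact: (measurableT_comp mG (@measurable_rVcons R n)).
Qed.

(** Induction on the dimension through Tonelli: the inner integral absorbs the tail of [u], the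
    outer one its first coordinate. *)
Lemma ge0_integral_rV_shift n (u : 'rV[R]_n) (G : 'rV[R]_n -> \bar R) :
  measurable_fun setT G -> (forall x, 0 <= G x) ->
  \int[mu n]_x G (x + u)%R = \int[mu n]_x G x.
Proof.
elim: n u G => [|n IH] u G mG G0.
  by apply: eq_integral => x _; congr G; apply/rowP => -[].
have mGu : measurable_fun setT (fun x : 'rV[R]_n.+1 => G (x + u)%R).
  exact: (measurableT_comp mG (measurable_rV_shift u)).
rewrite (ge0_integral_rVcons mG G0) (ge0_integral_rVcons mGu (fun x => G0 _)).
pose f t := \int[mu n]_x G (rVcons (t, x)).
transitivity (\int[lebesgue_measure]_t f (t + u ord0 ord0)%R).
  apply: eq_integral => t _; rewrite /f.
  rewrite -(IH (rV_tail u) (fun x => G (rVcons (_, x))))//.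
    by apply: eq_integral => x _; rewrite rVcons_add.
  exact: measurable_fun_slice.
rewrite -[in LHS](preimage_setT (fun t : R => t + u ord0 ord0)%R).
apply: ge0_integral_shift => //; first exact: measurable_fun_integral_slice.
by move=> t; exact: integral_ge0.
Qed.

Lemma measurable_unit_cell n : measurable (unit_cell R n).
Proof. exact: measurable_open_box. Qed.

Lemma lebesgue_unit_cell n : mu n (unit_cell R n) = 1.
Proof.
rewrite lebesgue_rV_box => [|i]; last by rewrite !mxE; lra.
by rewrite big1// => i _; rewrite !mxE; lra.
Qed.

Lemma unit_cell_rVcons n t (x : 'rV[R]_n) :
  unit_cell R n.+1 (rVcons (t, x)) <-> icell t /\ unit_cell R n x.
Proof.
rewrite /= in_itv/=; split=> [H|[t1 x1] i].
  split; first by move: (H ord0); rewrite rVcons0 !mxE.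
  by move=> i; move: (H (lift ord0 i)); rewrite rVconsS !mxE.
case: (unliftP ord0 i) => [j|] ->.
  by move: (x1 j); rewrite rVconsS !mxE.
by rewrite rVcons0 !mxE.
Qed.

Lemma ge0_integral_cell_rVcons n (G : 'rV[R]_n.+1 -> \bar R) :
  measurable_fun setT G -> (forall x, 0 <= G x) ->
  \int[mu n.+1]_(x in unit_cell R n.+1) G x =
  \int[lebesgue_measure]_(t in icell)
    \int[mu n]_(x in unit_cell R n) G (rVcons (t, x)).
Proof.
move=> mG G0.
have mGY := measurable_fun_patch (@measurable_unit_cell n.+1) mG.
have GY0 x : 0 <= (G \_ (unit_cell R n.+1)) x by exact: erestrict_ge0.
rewrite integral_mkcond (ge0_integral_rVcons mGY GY0).
rewrite [RHS]integral_mkcond; apply: eq_integral => t _; rewrite patchE.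
case: ifPn => [|] tI.
  rewrite [RHS]integral_mkcond; apply: eq_integral => x _; rewrite !patchE.
  congr (if _ then _ else _); apply/idP/idP => /set_mem H; apply/mem_set.
    by have /unit_cell_rVcons[] := H.
  by apply/unit_cell_rVcons; split => //; exact: set_mem.
apply: integral0_eq => x _; rewrite patchE ifF//; apply/negP => /set_mem.
by move=> /unit_cell_rVcons[/mem_set]; rewrite (negbTE tI).
Qed.

(** The induction of [ge0_integral_rV_shift], with the one-dimensional invariance over a period in
    the outer integral. *)
Lemma ge0_integral_cell_periodic n (u : 'rV[R]_n) (G : 'rV[R]_n -> \bar R) :
  measurable_fun setT G -> (forall x, 0 <= G x) ->
  (forall k x, G (x + delta_mx ord0 k)%R = G x) ->
  \int[mu n]_(x in unit_cell R n) G (x + u)%R =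
  \int[mu n]_(x in unit_cell R n) G x.
Proof.
elim: n u G => [|n IH] u G mG G0 Gper.
  by apply: eq_integral => x _; congr G; apply/rowP => -[].
have mGu : measurable_fun setT (fun x : 'rV[R]_n.+1 => G (x + u)%R).
  exact: (measurableT_comp mG (measurable_rV_shift u)).
rewrite (ge0_integral_cell_rVcons mG G0).
rewrite (ge0_integral_cell_rVcons mGu (fun x => G0 _)).
pose f t := \int[mu n]_(x in unit_cell R n) G (rVcons (t, x)).
transitivity (\int[lebesgue_measure]_(t in icell) f (t + u ord0 ord0)%R).
  apply: eq_integral => t _; rewrite /f.
  rewrite -(IH (rV_tail u) (fun x => G (rVcons (_, x))))//.
  - by apply: eq_integral => x _; rewrite rVcons_add.
  - exact: measurable_fun_slice.
  - by move=> k x; rewrite rVcons_deltaS.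
apply: ge0_integral_periodic.
- rewrite /f; under eq_fun do rewrite integral_mkcond.
  (* Measurability of the inner integral in [t]: it is the full slice integral of [G] extended by 0
     off the cylinder over the [n]-dimensional cell. *)
  pose H (x : 'rV[R]_n.+1) := (G \_ [set x | unit_cell R n (rV_tail x)]) x.
  have mtl : measurable_fun setT (@rV_tail n).
    apply/measurable_fun_rVP => i; under eq_fun do rewrite mxE.
    exact: measurable_coord.
  have := @measurable_fun_integral_slice n H.
  rewrite (_ : (fun t => _) = (fun t : measurableTypeR R =>
    \int[mu n]_x ((fun x => G (rVcons (t, x))) \_ (unit_cell R n)) x)).
    apply; last by move=> x; exact: erestrict_ge0.
    apply: measurable_fun_patch => //.
    by rewrite -[X in measurable X]setTI; apply: mtl => //; exact: measurable_unit_cell.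
  apply/funext => t; apply: eq_integral => x _; rewrite /H !patchE.
  have -> : rVcons (t, x) \in [set x0 | unit_cell R n (rV_tail x0)] =
      (x \in unit_cell R n).
    have xE : rV_tail (rVcons (t, x)) = x by apply/rowP => i; rewrite mxE rVconsS.
    by apply/idP/idP => /set_mem/= H1; apply/mem_set => /=; move: H1; rewrite xE.
  by [].
- by move=> t; exact: integral_ge0.
- by move=> t; apply: eq_integral => x _; rewrite rVcons_delta0 Gper.
Qed.

End lebesgue_rV_periodic.

(** * Averages of dilated periodic functions *)

Section cell_average.
Context {R : realType} {n : nat}.
Local Notation mu := (lebesgue_rV R n).
Local Notation Y := (unit_cell R n).
Local Open Scope ereal_scope.
Variable G : 'rV[R]_n -> \bar R.
Hypothesis mG : measurable_fun setT G.
Hypothesis G0 : forall x, 0 <= G x.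
Hypothesis Gper : forall k x, G (x + delta_mx ord0 k)%R = G x.
Variable e : R.
Let Ge (s x : 'rV[R]_n) := G (e^-1 *: x + s)%R.

Lemma measurable_fun_dilated s : measurable_fun setT (Ge s).
Proof.
apply: (measurableT_comp mG).
exact: (measurableT_comp (measurable_rV_shift s) (measurable_rV_scale e^-1)).
Qed.

Let measurable_joint :
  measurable_fun setT (fun p : 'rV[R]_n * 'rV[R]_n => Ge p.1 p.2).
Proof.
have mj : measurable_fun setT
    (fun p : 'rV[R]_n * 'rV[R]_n => e^-1 *: p.2 + p.1)%R.
  apply: (iffRL (measurable_fun_rVP _)) => i.
  under eq_fun do rewrite !mxE; apply: measurable_funD.
    apply: measurable_funM => //.
    exact: (measurableT_comp (measurable_coord i) measurable_snd).
  exact: (measurableT_comp (measurable_coord i) measurable_fst).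
exact: (measurableT_comp mG mj).
Qed.

Let measurable_inner A : measurable A ->
  measurable_fun setT (fun s => \int[mu]_(x in A) Ge s x).
Proof.
move=> mA; under eq_fun do rewrite integral_mkcond.
pose h (p : 'rV[R]_n * 'rV[R]_n) := ((fun p => Ge p.1 p.2) \_ (setT `*` A)) p.
have <- : (fun s => \int[mu]_x h (s, x)) = (fun s => \int[mu]_x (Ge s \_ A) x).
  apply/funext => s; apply: eq_integral => x _; rewrite /h !patchE.
  by rewrite in_setX in_setT.
apply: (@measurable_fun_fubini_tonelli_F _ _ _ _ _ mu h) => [|x].
  by apply: measurable_fun_patch => //; exact: measurableX.
by apply: erestrict_ge0 => p _; exact: G0.
Qed.

(** After Tonelli, the integral over [s] for fixed [x] is a cell integral of [G] translated by
    [x/e], which periodicity makes independent of [x]. *)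
Lemma integral_cell_average A : measurable A ->
  \int[mu]_(s in Y) \int[mu]_(x in A) Ge s x = mu A * \int[mu]_(y in Y) G y.
Proof.
move=> mA; have mY := @measurable_unit_cell R n.
(* Extending by 0 off the rectangle lets Tonelli be applied on the whole product space. *)
pose h (p : 'rV[R]_n * 'rV[R]_n) := ((fun p => Ge p.1 p.2) \_ (Y `*` A)) p.
have mh : measurable_fun setT h.
  by apply: measurable_fun_patch => //; exact: measurableX.
have h0 p : 0 <= h p by apply: erestrict_ge0 => p' _; exact: G0.
transitivity (\int[mu]_s \int[mu]_x h (s, x)).
  rewrite integral_mkcond; apply: eq_integral => s _; rewrite patchE /h.
  under [RHS]eq_integral do rewrite patchE in_setX/=.
  case: (s \in Y) => /=; last by rewrite integral0.
  by rewrite integral_mkcond; apply: eq_integral => x _; rewrite patchE.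
rewrite (fubini_tonelli h mh h0) muleC -(integral_cst mu mA) [RHS]integral_mkcond.
apply: eq_integral => x _; rewrite patchE /h.
under eq_integral do rewrite patchE in_setX/= andbC.
case: (x \in A) => /=; last by rewrite integral0.
rewrite /cst -(ge0_integral_cell_periodic (e^-1 *: x)%R mG)//.
by rewrite [RHS]integral_mkcond; apply: eq_integral => s _; rewrite patchE /Ge addrC.
Qed.

Lemma ge0_integral_dilated_shift s (B : set 'rV[R]_n) : e != 0%R -> measurable B ->
  \int[mu]_(x in B) G (e^-1 *: x)%R =
  \int[mu]_(x in [set x | B (x + e *: s)%R]) Ge s x.
Proof.
move=> e0 mB; rewrite integral_mkcond -(ge0_integral_rV_shift (e *: s)); first last.
- by move=> x; exact: erestrict_ge0.
- apply: measurable_fun_patch => //.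
  exact: (measurableT_comp mG (measurable_rV_scale _)).
rewrite [RHS]integral_mkcond; apply: eq_integral => x _; rewrite !patchE /Ge.
by rewrite scalerDr scalerA mulVf// scale1r.
Qed.

Let measurable_shifted (s : 'rV[R]_n) (B : set 'rV[R]_n) : measurable B ->
  measurable [set x | B (x + e *: s)%R].
Proof.
by move=> mB; rewrite -[X in measurable X]setTI; exact: (measurable_rV_shift _).
Qed.

(** [A] is any set containing all translates of [B] by [- e s] with [s] in the cell; it plays the
    role of the outer neighbourhood. *)
Lemma integral_dilated_le (B A : set 'rV[R]_n) :
  e != 0%R -> measurable B -> measurable A ->
  (forall s x, Y s -> B (x + e *: s)%R -> A x) ->
  \int[mu]_(x in B) G (e^-1 *: x)%R <= mu A * \int[mu]_(y in Y) G y.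
Proof.
move=> e0 mB mA BA; have mY := @measurable_unit_cell R n.
(* Since the cell has measure 1, the left side is the integral over [s] of a constant, which can be
   compared with the average for each [s] separately. *)
rewrite -(integral_cell_average mA) -[leLHS]mule1 -(@lebesgue_unit_cell R n).
rewrite -(integral_cst mu mY).
apply: ge0_le_integral => //.
- by move=> s _; apply: integral_ge0 => x _; exact: G0.
- by apply: measurable_funTS; exact: measurable_inner.
move=> s Ys; rewrite /cst (ge0_integral_dilated_shift s)//.
apply: ge0_subset_integral => //.
- exact: measurable_shifted.
- by apply: measurable_funTS; exact: measurable_fun_dilated.
- by move=> x _; exact: G0.
- by move=> x; exact: (BA s x Ys).
Qed.

Lemma integral_dilated_ge (B A : set 'rV[R]_n) :
  e != 0%R -> measurable B -> measurable A ->
  (forall s x, Y s -> A x -> B (x + e *: s)%R) ->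
  mu A * \int[mu]_(y in Y) G y <= \int[mu]_(x in B) G (e^-1 *: x)%R.
Proof.
move=> e0 mB mA AB; have mY := @measurable_unit_cell R n.
rewrite -(integral_cell_average mA) -[leRHS]mule1 -(@lebesgue_unit_cell R n).
rewrite -(integral_cst mu mY).
apply: ge0_le_integral => //.
- by move=> s _; apply: integral_ge0 => x _; exact: G0.
- by apply: measurable_funTS; exact: measurable_inner.
move=> s Ys; rewrite /cst (ge0_integral_dilated_shift s)//.
apply: ge0_subset_integral => //.
- exact: measurable_shifted.
- by apply: measurable_funTS; exact: measurable_fun_dilated.
- by move=> x _; exact: G0.
- by move=> x; exact: (AB s x Ys).
Qed.

End cell_average.

(** * Weak convergence to a constant *)

Import HBSimple.

Section weak_limit.
Context d (T : measurableType d) (R : realType) (mu : {measure set T -> \bar R}).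
Context (D : set T) (I : Type) (F : set_system I) (h : I -> T -> R) (M m : R).
Hypothesis FF : Filter F.
Hypothesis mD : measurable D.
Hypothesis Doo : (mu D < +oo)%E.
Hypothesis mh : forall i, measurable_fun D (h i).
Hypothesis hM : forall i x, `|h i x| <= M.
Implicit Types phi psi : T -> R.

Let int phi := mu.-integrable D (EFin \o phi).

Let weak_cvg phi :=
  \int[mu]_(x in D) (phi x * h i x) @[i --> F] --> \int[mu]_(x in D) phi x * m.

Lemma integrable_mul_bounded phi i : int phi -> int (fun x => phi x * h i x).
Proof.
move=> iphi; have := @integrableMl _ _ _ mu D mD (EFin \o phi) (h i) iphi (mh i).
apply; exists M; split; first exact: num_real.
by move=> y My x _; exact: le_trans (hM i x) (ltW My).
Qed.

Lemma weak_cvg_lin phi psi (a c : R) : int phi -> int psi ->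
  weak_cvg phi -> weak_cvg psi -> weak_cvg (fun x => a * phi x + c * psi x).
Proof.
move=> iphi ipsi tphi tpsi.
have iZ (b : R) f : int f -> int (fun x => b * f x).
  by move=> /(integrableZl mD b).
rewrite /weak_cvg RintegralD//; try exact: iZ.
rewrite !RintegralZl// mulrDl -!mulrA.
rewrite (_ : (fun i => _) = (fun i => a * \int[mu]_(x in D) (phi x * h i x) +
   c * \int[mu]_(x in D) (psi x * h i x))).
  by apply: cvgD; apply: cvgMr.
apply/funext => i.
rewrite -!RintegralZl -?RintegralD//; try exact: integrable_mul_bounded.
- by apply: eq_Rintegral => x _; rewrite mulrDl !mulrA.
- by apply: iZ; exact: integrable_mul_bounded.
- by apply: iZ; exact: integrable_mul_bounded.
Qed.

(** Replacing [phi] by [psi] changes the integrals against [h i] by at most [|M|] times their L^1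
    distance, uniformly in [i], and the limit by at most [|m|] times it. *)
Lemma weak_cvg_L1_closed phi : int phi ->
  (forall eta, 0 < eta -> exists psi,
     [/\ int psi, weak_cvg psi & \int[mu]_(x in D) `|phi x - psi x| <= eta]) ->
  weak_cvg phi.
Proof.
move=> iphi H; apply/cvgrPdist_le => eps eps0.
(* The factors of the two replacement errors; the extra 1 keeps [C] positive for the division. *)
pose C := `|M| + `|m| + 1.
have C0 : 0 < C by rewrite /C; have := normr_ge0 M; have := normr_ge0 m; lra.
have e2 : 0 < eps / 2 by lra.
have [psi [ipsi tpsi dpsi]] := H (eps / 2 / C) (divr_gt0 e2 C0).
move/cvgrPdist_le : tpsi => /(_ _ e2); apply: filterS => i ti.
have iD : int (fun x => phi x - psi x).
  have := integrableB mD iphi ipsi; exact.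
set J := \int[mu]_(x in D) `|phi x - psi x| in dpsi *.
have hJ : `|\int[mu]_(x in D) (phi x * h i x) - \int[mu]_(x in D) (psi x * h i x)|
    <= `|M| * J.
  rewrite -RintegralB//; try exact: integrable_mul_bounded.
  have iDh := integrable_mul_bounded i iD.
  rewrite (@eq_Rintegral _ _ _ _ _ (fun x => (phi x - psi x) * h i x)); last first.
    by move=> x _; rewrite mulrBl.
  apply: le_trans (le_normr_Rintegral mD iDh) _.
  have iN : int (fun x => `|phi x - psi x|) by exact: integrable_norm.
  rewrite -RintegralZl//; apply: le_Rintegral => //.
  - exact: (integrable_norm iDh).
  - exact: (integrableZl mD `|M| iN).
  - move=> x _; rewrite normrM mulrC ler_wpM2r//.
    by rewrite (le_trans (hM i x))// ler_norm.
have mJ : `|\int[mu]_(x in D) phi x - \int[mu]_(x in D) psi x| <= J.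
  by rewrite -RintegralB//; exact: le_normr_Rintegral.
have J0 : 0 <= J by exact: Rintegral_ge0.
have CJ : (`|M| + `|m|) * J <= eps / 2.
  move: dpsi; rewrite ler_pdivlMr// mulrC; apply: le_trans.
  by rewrite ler_wpM2r// /C lerDl.
move: hJ mJ ti; set a := \int[mu]_(x in D) (phi x * _).
set a' := \int[mu]_(x in D) (psi x * _); set b := \int[mu]_(x in D) phi x.
set b' := \int[mu]_(x in D) psi x => hJ mJ ti.
rewrite (_ : b * m - a = (b - b') * m + (b' * m - a') + (a' - a)); last by ring.
have : `|(b - b') * m| <= `|m| * J by rewrite normrM mulrC ler_wpM2l.
rewrite distrC in hJ.
move: (ler_normD ((b - b') * m + (b' * m - a')) (a' - a)).
move: (ler_normD ((b - b') * m) (b' * m - a')).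
nra.
Qed.

Lemma integrable_indic_fin A : measurable A -> int \1_A.
Proof.
move=> mA; apply: measurable_bounded_integrable => //.
exists 1; split; first exact: num_real.
move=> y y1 x _; apply: (le_trans _ (ltW y1)).
by rewrite indicE; case: (_ \in _); rewrite ?normr1 ?normr0.
Qed.

(** The sets whose indicator satisfies the convergence form a Dynkin system: complements follow by
    linearity, disjoint unions by [weak_cvg_L1_closed] applied to the finite partial unions. *)
Lemma weak_cvg_generated (G : set (set T)) :
  @measurable _ T = <<s G >> -> setI_closed G ->
  weak_cvg \1_setT -> (forall A, G A -> weak_cvg \1_A) ->
  forall A, measurable A -> weak_cvg \1_A.
Proof.
move=> sG GI tT tG A; rewrite sG => sA.
apply: (@dynkin_induction _ T G (fun A => weak_cvg \1_A) sG GI tT tG _ _ A sA).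
- move=> S mS tS.
  rewrite (_ : \1_(~` S) = (fun x => 1 * \1_setT x + (-1) * \1_S x)).
    by apply: weak_cvg_lin => //; exact: integrable_indic_fin.
  apply/funext => x; rewrite !indicE in_setT in_setC; case: (x \in S) => /=; lra.
- move=> E mE tE PE.
  have mU : measurable (\bigcup_k E k) by exact: bigcupT_measurable.
  apply: weak_cvg_L1_closed => [|eta eta0]; first exact: integrable_indic_fin.
  pose S N := \big[setU/set0]_(k < N) E k.
  have mS N : measurable (S N) by exact: bigsetU_measurable.
  have tS N : weak_cvg \1_(S N).
    elim: N => [|N IH].
      rewrite (_ : \1_(S 0%N) = (fun x => 0 * \1_setT x + 0 * \1_setT x)).
        by apply: weak_cvg_lin => //; exact: integrable_indic_fin.
      by apply/funext => x; rewrite /S big_ord0 indicE in_set0 !mul0r addr0.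
    rewrite (_ : \1_(S N.+1) = (fun x => 1 * \1_(S N) x + 1 * \1_(E N) x)).
      by apply: weak_cvg_lin => //; exact: integrable_indic_fin.
    apply/funext => x; rewrite /S big_ord_recr/= -/(S N) !indicE in_setU !mul1r.
    have [xS|] := boolP (x \in S N); have [xE|] := boolP (x \in E N) => //=;
      rewrite ?addr0 ?add0r//.
    (* A point of both would lie in some [E k] with [k < N], and disjointness would force
       [k = N]. *)
    exfalso; move: xS xE; rewrite !inE /S -bigcup_mkord => -[k /= kN Ekx] ENx.
    by move: kN; rewrite (tE k N) ?ltnn//; exists x.
  (* The remainders decrease to the empty set inside [D], which has finite measure, so [mu] is
     continuous from above along them. *)
  have : mu (((\bigcup_k E k) `\` S N) `&` D) @[N --> \oo] --> 0%E.
    rewrite -(measure0 mu) (_ : set0 = \bigcap_N (((\bigcup_k E k) `\` S N) `&` D)).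
      apply: nonincreasing_cvg_mu.
      - rewrite (le_lt_trans _ Doo)// le_measure ?inE//.
        by apply: measurableI => //; exact: measurableD.
      - by move=> N; apply: measurableI => //; exact: measurableD.
      - apply: bigcapT_measurable => N.
        by apply: measurableI => //; exact: measurableD.
      - move=> N N' NN'; apply/subsetPset; apply: setSI; apply: setDS.
        exact: subset_bigsetU.
    apply/esym; rewrite -subset0 => x /= H.
    have [[[k _ Ekx] _] _] := H 0%N Logic.I.
    have [[_ Sx] _] := H k.+1 Logic.I; apply: Sx.
    by rewrite /S -bigcup_mkord; exists k => /=.
  move=> /fine_cvgP[_ /cvgrPdist_le /(_ _ eta0)] [N _ /(_ N (leqnn N))] /=.
  rewrite sub0r normrN => le_eta; exists \1_(S N); split => //.
    exact: integrable_indic_fin.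
  apply: le_trans le_eta; apply: le_trans (ler_norm _).
  rewrite /Rintegral -integral_indic//; last exact: measurableD.
  rewrite le_eqVlt; apply/orP; left; apply/eqP; congr fine.
  apply: eq_integral => x _; congr (_%:E); rewrite !indicE in_setD.
  have SU : x \in S N -> x \in \bigcup_k E k.
    by rewrite !inE /S -bigcup_mkord => -[k _ Ek]; exists k.
  move: SU; case: (x \in S N) => /= [->//|_]; first by rewrite subrr normr0.
  by rewrite subr0 andbT ger0_norm.
Qed.

(** Simple functions approximate [phi] in L^1, and each is a finite linear combination of indicators
    of its level sets. *)
Lemma weak_cvg_integrable phi : (forall A, measurable A -> weak_cvg \1_A) ->
  int phi -> weak_cvg phi.
Proof.
move=> tA iphi; apply: weak_cvg_L1_closed => // eta eta0.
have [g [ig _ g0]] := approximation_sfun_integrable mD iphi.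
move/fine_cvgP : g0 => [_ /cvgrPdist_le /(_ _ eta0)] [N _ /(_ N (leqnn N))] /=.
rewrite sub0r normrN => le_eta; exists (g N); split; [exact: ig| |]; last first.
  exact: le_trans (ler_norm _) le_eta.
set s : seq R := finmap.enum_fset (fset_set (range (g N))).
have gE x : g N x = \sum_(k < size s) (s`_k * \1_(g N @^-1` [set s`_k]) x).
  exact: fimfunEord.
(* Truncating the level-set expansion after [K] values allows induction on [K], with integrability
   carried along for the linearity lemma. *)
pose G K x := \sum_(k < K) (s`_k * \1_(g N @^-1` [set s`_k]) x).
suff GK K : int (G K) /\ weak_cvg (G K).
  rewrite (_ : (g N : T -> R) = G (size s)); first by case: (GK (size s)).
  by apply/funext => x; rewrite gE.
have mP k : measurable (g N @^-1` [set s`_k]).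
  by rewrite -[X in measurable X]setTI; exact: measurable_funP.
elim: K => [|K [iG tG]].
  have -> : G 0%N = (fun x => 0 * \1_setT x + 0 * \1_setT x).
    by apply/funext => x; rewrite /G big_ord0; lra.
  split; last first.
    by apply: weak_cvg_lin => //; [exact: integrable_indic_fin..|exact: tA|exact: tA].
  rewrite (_ : (fun x => _) = cst 0); first exact: integrable0.
  by apply/funext => x /=; lra.
have -> : G K.+1 = (fun x => 1 * G K x + s`_K * \1_(g N @^-1` [set s`_K]) x).
  by apply/funext => x; rewrite /G big_ord_recr/= mul1r.
have ii := integrable_indic_fin (mP K).
split; last by apply: weak_cvg_lin => //; exact: tA.
have := integrableD mD iG (integrableZl mD s`_K ii).
by under [X in _ -> int X]funext do rewrite mul1r.
Qed.

End weak_limit.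

(** * Oscillating periodic functions tested on boxes *)

Section oscillating_average.
Context {R : realType} {n : nat}.
Local Notation mu := (lebesgue_rV R n).
Local Notation Y := (unit_cell R n).
Variables (f : 'rV[R]_n -> R) (M : R).
Hypothesis mf : measurable_fun setT f.
Hypothesis f0 : forall x, 0 <= f x.
Hypothesis fM : forall x, f x <= M.
Hypothesis fper : cell_periodic f.
Let m := \int[mu]_(y in Y) f y.

Let fN x : `|f x| <= M. Proof. by rewrite ger0_norm. Qed.

Let mfe e (D : set 'rV[R]_n) : measurable_fun D (fun x => f (e^-1 *: x)).
Proof.
by apply: measurable_funTS; exact: (measurableT_comp mf (measurable_rV_scale _)).
Qed.

Let bounded_integrable (g : 'rV[R]_n -> R) D : measurable D -> (mu D < +oo)%E ->
  measurable_fun D g -> (forall x, `|g x| <= M) -> mu.-integrable D (EFin \o g).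
Proof.
move=> mD Doo mg gM; apply: measurable_bounded_integrable => //.
exists M; split; first exact: num_real.
by move=> y My x _; exact: le_trans (gM x) (ltW My).
Qed.

Let mE : (\int[mu]_(y in Y) (f y)%:E)%E = m%:E.
Proof.
rewrite /m /Rintegral fineK//; apply: integrable_fin_num.
  exact: measurable_unit_cell.
apply: bounded_integrable => //; first exact: measurable_unit_cell.
- by rewrite lebesgue_unit_cell ltry.
- exact: measurable_funTS.
Qed.

Lemma open_box_fin (a c : 'rV[R]_n) : (mu (open_box a c) < +oo)%E.
Proof.
pose c' : 'rV[R]_n := \row_i Num.max (a ord0 i) (c ord0 i).
apply: (@le_lt_trans _ _ (mu (open_box a c'))).
  apply: le_measure; rewrite ?inE; try exact: measurable_open_box.
  by move=> x H i; have /andP[-> xc] := H i; rewrite mxE lt_max xc orbT.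
by rewrite lebesgue_rV_box ?ltry// => i; rewrite mxE le_max lexx.
Qed.

(** The integral is squeezed between [m] times the volumes of the box shrunk and enlarged by [e] on
    every side, that is [v (- e)] and [v e], both tending to the volume of the box. *)
Lemma cvg_integral_box (a c : 'rV[R]_n) :
  \int[mu]_(x in open_box a c) f (e^-1 *: x) @[e --> 0^'+] -->
  fine (mu (open_box a c)) * m.
Proof.
have [ac|] := pselect (forall i, a ord0 i < c ord0 i); last first.
  move=> /existsNP[i ac]; have -> : open_box a c = set0.
    rewrite -subset0 => x /(_ i) /andP[ax xc]; apply: ac; exact: lt_trans xc.
  rewrite measure0 mul0r; under eq_fun do rewrite Rintegral_set0.
  exact: cvg_cst.
pose v (e : R) := \prod_i (c ord0 i - a ord0 i + 2 * e).
have vcvg : v e @[e --> 0] --> fine (mu (open_box a c)).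
  rewrite lebesgue_rV_box/= => [|i]; last exact/ltW.
  rewrite (eq_bigr (fun i => c ord0 i - a ord0 i + 2 * 0)) => [|i _]; last first.
    by rewrite mulr0 addr0.
  apply: (@continuous_big R _ *%R 1 xpredT mul_continuous R _
    (fun i e => c ord0 i - a ord0 i + 2 * e)) => i _ e.
  by apply: cvgD; [exact: cvg_cst|apply: cvgMr; exact: cvg_id].
have vE e : (forall i, a ord0 i - e <= c ord0 i + e) ->
    mu (open_box (a - const_mx e) (c + const_mx e)) = (v e)%:E.
  move=> ae; rewrite lebesgue_rV_box => [|i]; last by rewrite !mxE.
  by congr (_%:E); apply: eq_bigr => i _; rewrite !mxE; lra.
apply: (@squeeze_cvgr _ _ _ _ (fun e => v (- e) * m) (fun e => v e * m)).
(* The shrunk box must keep its corners in order, since only then is its volume the product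
   [v (- e)]. *)
- have small : \forall e \near 0^'+, forall i, a ord0 i + e <= c ord0 i - e.
    apply: filter_forall => i; near=> e.
    have : e <= (c ord0 i - a ord0 i) / 2.
      by near: e; apply: nbhs_right_le; rewrite divr_gt0// subr_gt0.
    lra.
  near=> e; have e0 : 0 < e by near: e; exact: nbhs_right_gt.
  have sm : forall i, a ord0 i + e <= c ord0 i - e by near: e.
  have := open_box_fin a c; set B := open_box a c => Boo.
  have mB : measurable B by exact: measurable_open_box.
  have en0 : e != 0 by rewrite gt_eqF.
  have IE : (\int[mu]_(x in B) (f (e^-1 *: x))%:E)%E =
      (\int[mu]_(x in B) f (e^-1 *: x))%:E.
    rewrite /Rintegral fineK//; apply: integrable_fin_num => //.
    exact: bounded_integrable.
  have mEf : measurable_fun setT (EFin \o f) by exact/measurable_EFinP.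
  have Ef0 x : (0 <= (EFin \o f) x)%E by rewrite lee_fin.
  have Efper k x : (EFin \o f) (x + delta_mx ord0 k) = (EFin \o f) x.
    by rewrite /= fper.
  rewrite -!lee_fin !EFinM -IE -mE -!vE => [|i|i]; last 2 first.
  - by have := ac i; lra.
  - by have := sm i; rewrite opprK; lra.
  (* The cell has half-width 1/2, so a translation by [e s] stays well within the margin [e]. *)
  have Ycoord (s : 'rV[R]_n) i : Y s -> - e < e * s ord0 i < e.
    move=> /(_ i); rewrite !mxE => ?; apply/andP; split; nra.
  apply/andP; split.
    apply: (integral_dilated_ge mEf Ef0 Efper) => //; first exact: measurable_open_box.
    move=> s x Ys Ax i; move: (Ax i) (Ycoord s i Ys).
    rewrite !mxE => /andP[? ?] /andP[? ?].
    by apply/andP; split; lra.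
  apply: (integral_dilated_le mEf Ef0 Efper) => //; first exact: measurable_open_box.
  move=> s x Ys Bx i; move: (Bx i) (Ycoord s i Ys).
  rewrite !mxE => /andP[? ?] /andP[? ?].
  by apply/andP; split; lra.
- apply: cvgMl; apply: (@cvg_comp _ _ _ -%R v _ (nbhs (0 : R))) => //.
  have : (- e)%R @[e --> (0 : R)^'+] --> - (0 : R).
    by apply: cvgN; apply: cvg_at_right_filter; exact: cvg_id.
  by rewrite oppr0.
- by apply: cvgMl; exact: cvg_at_right_filter.
Unshelve. all: by end_near. Qed.

(** Boxes are stable under intersection, so testing on the indicator of a box, or of the whole
    space, within [D] is an instance of [cvg_integral_box]. *)
Lemma cvg_integral_oscillating (a c : 'rV[R]_n) phi :
  mu.-integrable (open_box a c) (EFin \o phi) ->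
  \int[mu]_(x in open_box a c) (phi x * f (e^-1 *: x)) @[e --> 0^'+] -->
  \int[mu]_(x in open_box a c) phi x * m.
Proof.
set D := open_box a c; have mD : measurable D by exact: measurable_open_box.
have Doo : (mu D < +oo)%E by exact: open_box_fin.
pose h (e : R) (x : 'rV[R]_n) := f (e^-1 *: x).
have mh e : measurable_fun D (h e) by exact: mfe.
have hM e x : `|h e x| <= M by exact: fN.
apply: (@weak_cvg_integrable _ _ R mu D R (at_right 0) h M m _ mD Doo mh hM phi).
apply: (@weak_cvg_generated _ _ R mu D R (at_right 0) h M m _ mD Doo mh hM boxes
  measurable_rV_boxes setI_closed_boxes); rewrite /h.
  under eq_fun do under eq_Rintegral do rewrite indicE in_setT mul1r.
  rewrite (_ : \int[mu]_(x in D) \1_setT x = fine (mu D)).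
    exact: cvg_integral_box.
  by rewrite /Rintegral integral_indic// setTI.
move=> A [a' [c' AE]].
have [a1 [c1 DAE]] : boxes (D `&` A).
  by apply: setI_closed_boxes; [exists a, c|exists a', c'].
have mA : measurable A by rewrite AE; exact: measurable_open_box.
have ind g : \int[mu]_(x in D) (\1_A x * g x) = \int[mu]_(x in D `&` A) g x.
  rewrite Rintegral_mkcondr; apply: eq_Rintegral => x _.
  by rewrite patchE indicE; case: (x \in A); rewrite ?mul1r ?mul0r.
under eq_fun do rewrite ind.
rewrite (_ : \int[mu]_(x in D) \1_A x = fine (mu (D `&` A))).
  by rewrite DAE; exact: cvg_integral_box.
by rewrite /Rintegral integral_indic// setIC.
Qed.

End oscillating_average.

(** * Partial derivatives of Lipschitz functions *)

Section partials.
Context {R : realType} {n : nat}.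
Implicit Types (f : 'rV[R]_n -> R) (k : 'I_n) (x y : 'rV[R]_n).

(** The increment is added on the left so that the quotient is convertible to the one whose limit
    defines ['D_]. *)
Definition diff_quot k f x (h : R) := h^-1 * (f (h *: delta_mx ord0 k + x) - f x).

Lemma cvg_partial k f x (l : R) :
  diff_quot k f x h @[h --> 0^'] --> l -> partial k f x = l.
Proof. exact: cvg_lim. Qed.

Lemma cvg_diff_quot k f x : derivable f x (delta_mx ord0 k) ->
  diff_quot k f x h @[h --> 0^'] --> partial k f x.
Proof. by []. Qed.

(* [lim] of a non-convergent filter is [point], which is 0 in R. *)
Lemma partial_nonderivable k f x :
  ~ derivable f x (delta_mx ord0 k) -> partial k f x = 0.
Proof. by move=> ndf; rewrite /partial /derive dvgP. Qed.

Lemma cvg_diff_quot_dilation k f (a c : R) x (l : R) : c != 0 ->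
  diff_quot k f (c *: x) h @[h --> 0^'] --> l ->
  diff_quot k (fun x => a * f (c *: x)) x h @[h --> 0^'] --> a * c * l.
Proof.
move=> c0 fl; rewrite (_ : (fun h => _) =
    fun h => a * c * diff_quot k f (c *: x) (c * h)); last first.
  apply/funext => h; rewrite /diff_quot scalerDr scalerA -mulrBr invfM.
  by rewrite -!mulrA (mulrCA c) mulKf// mulrCA.
apply: cvgMr; apply: cvg_comp fl => A /= [r r0 rA].
exists (r / `|c|) => /=; first by rewrite divr_gt0// normr_gt0.
move=> h /= ; rewrite !sub0r !normrN ltr_pdivlMr ?normr_gt0// => hr h0.
by apply: rA => /=; rewrite ?sub0r ?normrN ?normrM 1?mulrC// mulf_neq0.
Qed.

(** Valid at every point: if [f] has no partial derivative at [c x], neither has the dilated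
    function at [x], as the inverse dilation would transport it back, and both sides take the
    default value 0. *)
Lemma partial_dilation k f (a c : R) x : a != 0 -> c != 0 ->
  partial k (fun x => a * f (c *: x)) x = a * c * partial k f (c *: x).
Proof.
move=> a0 c0; have [df|ndf] := pselect (derivable f (c *: x) (delta_mx ord0 k)).
  exact/cvg_partial/cvg_diff_quot_dilation/cvg_diff_quot.
rewrite (partial_nonderivable ndf) mulr0; apply: partial_nonderivable => dg.
apply: ndf; have c0' : c^-1 != 0 by rewrite invr_eq0.
have xE : c^-1 *: (c *: x) = x by rewrite scalerA mulVf// scale1r.
rewrite -{1}xE in dg.
have H := @cvg_diff_quot_dilation k _ a^-1 c^-1 (c *: x) _ c0' (cvg_diff_quot dg).
have gf : (fun y => a^-1 * (a * f (c *: (c^-1 *: y)))) = f.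
  by apply/funext => y; rewrite scalerA mulfV// scale1r mulKf.
by rewrite gf in H; apply/cvg_ex; eexists; exact: H.
Qed.

Lemma partial_shift k f (u : 'rV[R]_n) x :
  (forall y, f (y + u) = f y) -> partial k f (x + u) = partial k f x.
Proof.
move=> fu; rewrite -[LHS]/(lim (diff_quot k f (x + u) @ 0^')).
rewrite (_ : diff_quot k f (x + u) = diff_quot k f x)//.
by apply/funext => h; rewrite /diff_quot addrA !fu.
Qed.

Lemma lipschitz_continuous_rV f (L : R) : 0 <= L ->
  (forall x y, `|f x - f y| <= L * `|x - y|) -> continuous f.
Proof.
move=> L0 fL x A /= /nbhs_ballP[eps /= eps0 epsA].
(* Dividing by [L + 1] covers the case [L = 0]. *)
have L1 : 0 < L + 1 by rewrite ltr_wpDl.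
have e0 : 0 < eps / (L + 1) by rewrite divr_gt0.
change (nbhs x (f @^-1` A)); apply/nbhs_ballP; exists (eps / (L + 1)) => // y.
rewrite mx_norm_ball /ball_ /= => xy; apply: epsA; rewrite /ball /=.
apply: le_lt_trans (fL _ _) _.
have := normr_ge0 (x - y); move: xy; rewrite ltr_pdivlMr//; nra.
Qed.

Section lipschitz_partials.
Variables (f : 'rV[R]_n -> R) (L : R).
Hypothesis L0 : 0 <= L.
Hypothesis fL : forall x y, `|f x - f y| <= L * `|x - y|.

Lemma norm_delta_mx k : `|delta_mx ord0 k : 'rV[R]_n| <= 1.
Proof.
rewrite [leLHS]mx_normrE; apply: bigmax_le => //= ij _.
by rewrite mxE; case: (_ && _); rewrite ?normr1 ?normr0.
Qed.

Lemma diff_quot_le k x h : h != 0 -> `|diff_quot k f x h| <= L.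
Proof.
move=> h0; rewrite /diff_quot normrM normfV ler_pdivrMl ?normr_gt0//.
apply: le_trans (fL _ _) _; rewrite addrK mulrC ler_wpM2r// normrZ.
by rewrite ler_piMr// norm_delta_mx.
Qed.

(** Where the partial derivative does not exist, its default value 0 obeys the bound as well, so
    there is no exceptional set. *)
Lemma partial_le k x : `|partial k f x| <= L.
Proof.
have [df|ndf] := pselect (derivable f x (delta_mx ord0 k)); last first.
  by rewrite partial_nonderivable// normr0.
have H : `|diff_quot k f x h| @[h --> 0^'] --> `|partial k f x|.
  by apply: cvg_norm; exact: cvg_diff_quot.
apply: (cvgr_to_le H); near=> h; apply: diff_quot_le.
by near: h; exact: nbhs_dnbhs_neq.
Unshelve. all: by end_near. Qed.

Lemma continuous_diff_quot k h : continuous (fun x => diff_quot k f x h).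
Proof.
have hn : 0 <= `|h^-1| by [].
apply: (@lipschitz_continuous_rV _ (`|h^-1| * (L + L))) => [|x y].
  by rewrite mulr_ge0// addr_ge0.
rewrite /diff_quot -mulrBr normrM -mulrA ler_wpM2l//.
have -> (a b c e : R) : a - b - (c - e) = (a - c) + (e - b) by ring.
rewrite mulrDl (le_trans (ler_normD _ _))// lerD//.
  by rewrite (le_trans (fL _ _))// opprD addrACA subrr add0r.
by rewrite (le_trans (fL _ _))// distrC.
Qed.

(** The Cauchy criterion for the difference quotients, with tolerances [1/(i+1)] and [1/(j+1)] so
    that derivability becomes a countable combination of conditions on [x]. *)
Lemma derivableP k x : derivable f x (delta_mx ord0 k) <->
  forall i : nat, exists j : nat, forall h h' : R,
    0 < `|h| < j.+1%:R^-1 -> 0 < `|h'| < j.+1%:R^-1 ->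
    `|diff_quot k f x h - diff_quot k f x h'| <= i.+1%:R^-1.
Proof.
split=> [df i|H].
  have /cvgrPdist_le/(_ (i.+1%:R^-1 / 2)) := cvg_diff_quot df.
  have i0 : 0 < i.+1%:R^-1 / 2 :> R by rewrite divr_gt0// invr_gt0.
  move=> /(_ i0) [r /= r0 rP].
  have [j jr] := exists_invS_lt r0.
  exists j => h h' /andP[h0 hj] /andP[h'0 h'j].
  have A z : 0 < `|z| -> `|z| < j.+1%:R^-1 ->
      `|partial k f x - diff_quot k f x z| <= i.+1%:R^-1 / 2.
    move=> z0 zj; apply: rP => /=; first by rewrite sub0r normrN (lt_trans zj).
    by rewrite -normr_gt0.
  have := A _ h0 hj; rewrite distrC => B; have B' := A _ h'0 h'j.
  rewrite (le_trans (ler_distD (partial k f x) _ _))// [leRHS]splitr.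
  exact: lerD.
apply/cauchy_cvgP/cauchy_ballP => eps eps0.
have [i ie] := exists_invS_lt eps0.
have [j jP] := H i.
have j0 : 0 < j.+1%:R^-1 :> R by rewrite invr_gt0.
pose V : set R := [set h | 0 < `|h| < j.+1%:R^-1].
have VF : nbhs (0 : R)^' V.
  exists j.+1%:R^-1 => //= h /=; rewrite sub0r normrN => hj h0.
  by rewrite /V /= normr_gt0 h0.
exists (diff_quot k f x @` V, diff_quot k f x @` V).
  by split; apply: filterS VF => h Vh; exists h.
move=> [_ _] [/= [h Vh <-] [h' Vh' <-]]; rewrite /ball /= /ball_ /=.
exact: le_lt_trans (jP _ _ Vh Vh') ie.
Qed.

(* For fixed i and j the Cauchy condition on difference quotients is closed in x. *)
Lemma measurable_derivable k :
  measurable [set x | derivable f x (delta_mx ord0 k)].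
Proof.
pose E (i j : nat) := [set x | forall h h' : R,
    0 < `|h| < j.+1%:R^-1 -> 0 < `|h'| < j.+1%:R^-1 ->
    `|diff_quot k f x h - diff_quot k f x h'| <= i.+1%:R^-1].
rewrite (_ : [set _ | _] = \bigcap_i \bigcup_j E i j).
  apply: bigcapT_measurable => i; apply: bigcupT_measurable => j.
  apply: closed_measurable_rV.
  rewrite (_ : E i j = \bigcap_(p in [set p : R * R |
      0 < `|p.1| < j.+1%:R^-1 /\ 0 < `|p.2| < j.+1%:R^-1])
      ((fun x => `|diff_quot k f x p.1 - diff_quot k f x p.2|) @^-1`
        [set r | r <= i.+1%:R^-1])).
    apply: closed_bigI => -[h h'] _; apply: closed_comp; last exact: closed_le.
    move=> x _.
    have cB := continuousB (@continuous_diff_quot k h x)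
      (@continuous_diff_quot k h' x).
    exact: (continuous_comp cB (@norm_continuous _ _ _)).
  apply/seteqP; split => x; first by move=> H [h h'] [/= ? ?]; exact: H.
  by move=> H h h' ? ?; exact: (H (h, h')).
apply/seteqP; split => x.
  by move=> /derivableP H i _; have [j] := H i; exists j.
by move=> H; apply/derivableP => i; have [j _] := H i Logic.I; exists j.
Qed.

(** A pointwise limit of measurable functions: the quotients with step [1/(i+1)], multiplied by the
    indicator of the derivability set, which yields the default value 0 off that set. *)
Lemma measurable_partial k : measurable_fun setT (partial k f).
Proof.
pose D := [set x | derivable f x (delta_mx ord0 k)].
have mD : measurable D := measurable_derivable k.
apply: (measurable_fun_cvg
  (h := fun i x => diff_quot k f x i.+1%:R^-1 * \1_D x)) => [i|x _].
  apply: measurable_funM => //.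
  by apply: continuous_measurable_rV; exact: continuous_diff_quot.
have [df|ndf] := pselect (D x); last first.
  rewrite partial_nonderivable// indicE memNset//.
  by under eq_fun do rewrite mulr0; exact: cvg_cst.
rewrite -[partial k f x]mulr1 indicE mem_set//; apply: cvgMl.
apply: cvg_comp (cvg_diff_quot df) => A /= [r r0 rA].
have /cvgrPdist_lt/(_ r r0) := @cvg_harmonic R.
apply: filterS => i ir; apply: rA => /=; first exact: ir.
by rewrite invr_eq0.
Qed.

End lipschitz_partials.

End partials.

(** * Area density and oscillating profiles *)

Section area_density_theory.
Context {R : realType} {n : nat}.
Local Notation mu := (lebesgue_rV R n).
Implicit Types (f : 'rV[R]_n -> R) (k : 'I_n) (x y : 'rV[R]_n).

Lemma eucl_norm_ge0 p (x : 'rV[R]_p) : 0 <= eucl_norm x.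
Proof. exact: sqrtr_ge0. Qed.

Lemma sqr_eucl_norm p (x : 'rV[R]_p) : eucl_norm x ^+ 2 = \sum_i x ord0 i ^+ 2.
Proof. by rewrite sqr_sqrtr// sumr_ge0// => i _; exact: sqr_ge0. Qed.

Lemma sqr_eucl_norm_grad f x : eucl_norm (grad f x) ^+ 2 = \sum_k partial k f x ^+ 2.
Proof. by rewrite sqr_eucl_norm; apply: eq_bigr => k _; rewrite mxE. Qed.

Lemma area_density_ge0 f x : 0 <= area_density f x.
Proof. exact: sqrtr_ge0. Qed.

Lemma area_densityE f x :
  area_density f x = Num.sqrt (1 + \sum_k partial k f x ^+ 2).
Proof. by rewrite /area_density sqr_eucl_norm_grad. Qed.

Lemma lipschitzE f : lipschitz f ->
  exists2 L : R, 0 <= L & forall x y, `|f x - f y| <= L * `|x - y|.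
Proof.
move=> [M [_ /(_ (`|M| + 1))]].
have MM : M < `|M| + 1 by rewrite (le_lt_trans (ler_norm _))// ltrDl.
move=> /(_ MM) fL; exists (`|M| + 1) => // x y.
exact: (fL (x, y) (conj Logic.I Logic.I)).
Qed.

Section lipschitz_area.
Variables (f : 'rV[R]_n -> R) (L : R).
Hypothesis L0 : 0 <= L.
Hypothesis fL : forall x y, `|f x - f y| <= L * `|x - y|.

Lemma measurable_sqr_grad : measurable_fun setT (fun x => \sum_k partial k f x ^+ 2).
Proof.
apply: measurable_sum => k; apply: measurable_funX.
exact: (measurable_partial L0 fL).
Qed.

Lemma measurable_area_density : measurable_fun setT (area_density f).
Proof.
rewrite (_ : area_density f =
    fun x => Num.sqrt (1 + \sum_k partial k f x ^+ 2)); last first.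
  by apply/funext => x; exact: area_densityE.
apply: (measurableT_comp (continuous_measurable_fun (@sqrt_continuous R))).
by apply: measurable_funD => //; exact: measurable_sqr_grad.
Qed.

Lemma area_density_le x : area_density f x <= Num.sqrt (1 + n%:R * L ^+ 2).
Proof.
rewrite area_densityE ler_sqrt ?lerD2l; last first.
  by rewrite addr_ge0// mulr_ge0// sqr_ge0.
rewrite mulr_natl -[X in _ *+ X](card_ord n) -sumr_const; apply: ler_sum => k _.
by rewrite -[leLHS]real_normK ?num_real// ler_sqr ?nnegrE//; exact: (partial_le L0 fL).
Qed.

End lipschitz_area.

Lemma cell_periodic_partial f k : cell_periodic f -> cell_periodic (partial k f).
Proof. by move=> fper j x; apply: partial_shift => y; exact: fper. Qed.

Lemma cell_periodic_area f : cell_periodic f -> cell_periodic (area_density f).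
Proof.
move=> fper j x; rewrite !area_densityE; congr (Num.sqrt (_ + _)).
by apply: eq_bigr => k _; rewrite cell_periodic_partial.
Qed.

Lemma cell_periodic_int f (z : 'I_n -> int) x : cell_periodic f ->
  f (x + \row_i (z i)%:~R) = f x.
Proof.
move=> fper; rewrite [X in x + X]row_sum_delta.
under eq_bigr do rewrite mxE.
have nat_shift k (m : nat) y : f (y + m%:R *: delta_mx ord0 k) = f y.
  elim: m => [|m IH] in y *; first by rewrite scale0r addr0.
  by rewrite -natr1 scalerDl scale1r addrA fper IH.
have int_shift k (m : int) y : f (y + m%:~R *: delta_mx ord0 k) = f y.
  case: m => m; first exact: nat_shift.
  rewrite NegzE mulrNz scaleNr; set v := _ *: _.
  by rewrite -(nat_shift k m.+1 (y - v)) subrK.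
elim: (index_enum _) => [|i r IH] in x *; first by rewrite big_nil addr0.
by rewrite big_cons addrA IH int_shift.
Qed.

Lemma mx_norm_coord p (x : 'rV[R]_p) i : `|x ord0 i| <= `|x|.
Proof. by rewrite [leRHS]mx_normrE (le_bigmax _ _ (ord0, i)). Qed.

Lemma mx_norm_le p (x : 'rV[R]_p) (C : R) : 0 <= C ->
  (forall i, `|x ord0 i| <= C) -> `|x| <= C.
Proof.
move=> C0 xC; rewrite [leLHS]mx_normrE; apply: bigmax_le => //= -[i j] _ /=.
by rewrite (ord1 i).
Qed.

(** Subtracting integer parts moves any point into the unit cube, at sup distance at most 1 from the
    origin. *)
Lemma lipschitz_periodic_bounded f : lipschitz f -> cell_periodic f ->
  exists2 M : R, 0 <= M & forall x, `|f x| <= M.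
Proof.
move=> /lipschitzE[L L0 fL] fper; exists (`|f 0| + L); first by rewrite addr_ge0.
move=> x; rewrite -(cell_periodic_int (fun i => - Num.floor (x ord0 i)) x fper).
set y := x + _; have y1 : `|y| <= 1.
  apply: mx_norm_le => // i; rewrite !mxE mulrNz.
  have /andP[] := floor_itv (x ord0 i); rewrite intrD mulr1z.
  by move: (_%:~R : R) => z ? ?; rewrite ler_norml; apply/andP; split; lra.
have -> : f y = f 0 + (f y - f 0) by ring.
rewrite (le_trans (ler_normD _ _))// lerD2l (le_trans (fL _ _))// subr0.
by rewrite ler_piMr.
Qed.

(** The definition of the L^oo norm branches on this positivity; it selects the branch with the
    essential supremum. *)
Lemma lebesgue_rV_setT_gt0 : (0 < mu setT)%E.
Proof.
have mY := @measurable_unit_cell R n.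
by rewrite (lt_le_trans lte01)// -(@lebesgue_unit_cell R n) le_measure ?inE.
Qed.

Lemma Linfty_normE (D : set 'rV[R]_n) f :
  Linfty_norm D f = ess_sup mu (abse \o (EFin \o (f \_ D))).
Proof. by rewrite /Linfty_norm unlock /Lnorm.body lebesgue_rV_setT_gt0. Qed.

Lemma Linfty_norm_le (D : set 'rV[R]_n) f C : 0 <= C ->
  (forall x, `|f x| <= C) -> (Linfty_norm D f <= C%:E)%E.
Proof.
move=> C0 fC; rewrite Linfty_normE; apply/ess_supP; apply: nearW => x /=.
by rewrite lee_fin patchE; case: ifP => // _; rewrite normr0.
Qed.

End area_density_theory.

Lemma powR_pred (R : realType) (e a : R) : 0 < e -> e `^ (a - 1) = e `^ a * e^-1.
Proof. by move=> e0; rewrite powRD ?powR_inv1 ?(ltW e0)// (gt_eqF e0) implybT. Qed.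

Section oscillating_profile.
Context {R : realType} {n : nat}.
Local Notation mu := (lebesgue_rV R n).
Variables (b : 'rV[R]_n -> R) (alpha : R).
Hypotheses (b_lip : lipschitz b) (b_per : cell_periodic b).
Local Notation g := (oscillating alpha b).

Lemma oscillating_bounded : exists2 M : R, 0 <= M &
  forall e x, `|g e x| <= e `^ alpha * M.
Proof.
have [M M0 bM] := lipschitz_periodic_bounded b_lip b_per; exists M => // e x.
by rewrite /oscillating normrM ger0_norm ?powR_ge0// ler_wpM2l// powR_ge0.
Qed.

Lemma oscillating_lipschitz : exists2 L : R, 0 <= L & forall e, 0 < e ->
  forall x y, `|g e x - g e y| <= e `^ (alpha - 1) * L * `|x - y|.
Proof.
have [L L0 bL] := lipschitzE b_lip; exists L => // e e0 x y.
rewrite /oscillating -mulrBr normrM ger0_norm ?powR_ge0//.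
rewrite powR_pred// -!mulrA ler_wpM2l ?powR_ge0//.
rewrite (le_trans (bL _ _))// -scalerBr normrZ gtr0_norm ?invr_gt0//.
by rewrite mulrCA.
Qed.

Lemma partial_oscillating k e x : 0 < e ->
  partial k (g e) x = e `^ (alpha - 1) * partial k b (e^-1 *: x).
Proof.
move=> e0; rewrite /oscillating partial_dilation ?invr_eq0 ?gt_eqF ?powR_gt0//.
by rewrite powR_pred.
Qed.

Lemma cvg_Linfty_oscillating (W : set 'rV[R]_n) : 0 < alpha ->
  Linfty_norm W (g e) @[e --> 0^'+] --> 0%E.
Proof.
move=> alpha0; have [M M0 gM] := oscillating_bounded.
apply: (@squeeze_cvge _ _ _ _ (cst 0%E) _ (fun e => (e `^ alpha * M)%:E)).
- apply: nearW => e; rewrite Lnorm_ge0/= Linfty_norm_le//.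
  by rewrite mulr_ge0// powR_ge0.
- exact: cvg_cst.
- apply: cvg_EFin; first exact: nearW.
  by rewrite -[X in _ --> X](mul0r M); apply: cvgMl; exact: powR_cvg0.
Qed.

(** For [e <= 1] and [alpha >= 1] the factor [e^(alpha - 1)] is at most 1, so a Lipschitz constant
    of [b] serves as [C]. *)
Lemma Linfty_partial_oscillating (W : set 'rV[R]_n) k : 1 <= alpha ->
  exists C : R, \forall e \near 0^'+,
    (Linfty_norm W (partial k (g e)) <= C%:E)%E.
Proof.
move=> alpha1; have [L L0 bL] := lipschitzE b_lip; exists L; near=> e.
have e0 : 0 < e by near: e; exact: nbhs_right_gt.
apply: Linfty_norm_le => // x; rewrite partial_oscillating// normrM.
rewrite ger0_norm ?powR_ge0// -[leRHS]mul1r.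
apply: ler_pM; rewrite ?powR_ge0//; last exact: (partial_le L0 bL).
rewrite -[leRHS](powRr0 e); apply: ger_powR; last by rewrite subr_ge0.
by rewrite e0/=; near: e; apply: nbhs_right_le; exact: ltr01.
Unshelve. all: by end_near. Qed.

End oscillating_profile.

(** * Weak limit of the area density and measure of its sublevel sets *)

Section oscillating_area.
Context {R : realType} {n : nat}.
Local Notation mu := (lebesgue_rV R n).
Local Notation Y := (unit_cell R n).
Variables (b : 'rV[R]_n -> R) (W : set 'rV[R]_n) (K : R).
Hypotheses (b_lip : lipschitz b) (b_per : cell_periodic b).
Hypotheses (mW : measurable W) (WK : W `<=` cube K).

Let mK : measurable (cube K : set 'rV[R]_n). Proof. exact: measurable_open_box. Qed.

Let Woo : (mu W < +oo)%E.
Proof.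
apply: le_lt_trans (open_box_fin _ _).
by apply: le_measure; rewrite ?inE; [| |exact: WK].
Qed.

Lemma area_density_oscillating alpha e x : 0 < e ->
  area_density (oscillating alpha b e) x =
  Num.sqrt (1 + (e `^ (alpha - 1)) ^+ 2 * \sum_k partial k b (e^-1 *: x) ^+ 2).
Proof.
move=> e0; rewrite area_densityE mulr_sumr; congr (Num.sqrt (_ + _)).
by apply: eq_bigr => k _; rewrite partial_oscillating// exprMn.
Qed.

Lemma area_density_oscillating1 e x : 0 < e ->
  area_density (oscillating 1 b e) x = area_density b (e^-1 *: x).
Proof.
move=> e0; rewrite area_density_oscillating// subrr powRr0 expr1n mul1r.
by rewrite area_densityE.
Qed.

(** Test functions on [W] are extended by 0 to a cube containing [W], because the averaging results
    are stated on boxes. *)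
Lemma Linfty_integrable (phi : 'rV[R]_n -> R) : measurable_fun W phi ->
  (Linfty_norm W phi < +oo)%E -> mu.-integrable (cube K) (EFin \o (phi \_ W)).
Proof.
move=> mphi; rewrite Linfty_normE => phioo.
have mpW : measurable_fun setT (phi \_ W) by apply/(measurable_restrictT _ mW).
apply/integrableP; split; first exact/measurable_EFinP/measurable_funTS.
have := ess_sup_ge mu (abse \o (EFin \o (phi \_ W))).
set v := ess_sup _ _ in phioo * => phiv.
have voo : (maxe v 0 < +oo)%E by rewrite gt_max phioo ltry.
apply: (@le_lt_trans _ _ (\int[mu]_(x in cube K) (cst (maxe v 0)) x)%E).
  apply: ae_ge0_le_integral => //.
  - by apply: measurableT_comp => //; apply/measurable_EFinP/measurable_funTS.
  - by move=> x _; rewrite /cst le_max lexx orbT.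
  - by apply: filterS phiv => x /= H _; rewrite le_max H.
rewrite integral_cst//; apply: lte_mul_pinfty; rewrite ?le_max ?lexx ?orbT//.
  by rewrite ge0_fin_numE// le_max lexx orbT.
exact: open_box_fin.
Qed.

Lemma integral_restrict_cube (h : 'rV[R]_n -> R) :
  (\int[mu]_(x in W) (h x)%:E = \int[mu]_(x in cube K) ((h \_ W) x)%:E)%E.
Proof.
rewrite -[in LHS](setIidr WK) integral_mkcondr; apply: eq_integral => x _.
by rewrite !patchE; case: ifP.
Qed.

Lemma L1_weak_cvg_area : L1_weak_cvg W (fun e => area_density (oscillating 1 b e))
  (fun=> \int[mu]_(y in Y) area_density b y).
Proof.
have [L L0 bL] := lipschitzE b_lip.
set A := area_density b; set m := \int[mu]_(y in Y) A y.
have A0 x : 0 <= A x by exact: area_density_ge0.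
pose M := Num.sqrt (1 + n%:R * L ^+ 2).
have AM x : A x <= M by exact: area_density_le.
have mA : measurable_fun setT A := measurable_area_density L0 bL.
have mAe (e : R) : measurable_fun setT (fun x : 'rV[R]_n => A (e^-1 *: x)).
  exact: (measurableT_comp mA (measurable_rV_scale _)).
have mAD (D : set 'rV[R]_n) (e : R) :
    measurable_fun D (fun x : 'rV[R]_n => A (e^-1 *: x)).
  exact: (measurable_funTS (mAe e)).
have AN (e : R) (x : 'rV[R]_n) : `|A (e^-1 *: x)| <= M by rewrite ger0_norm.
split.
- move=> e e0.
  have -> : area_density (oscillating 1 b e) = (fun x => A (e^-1 *: x)).
    by apply/funext => x; exact: area_density_oscillating1.
  apply: (measurable_bounded_integrable mW Woo (mAD W e)).
  exists M; split; first exact: num_real.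
  by move=> y My x _; exact: le_trans (AN e x) (ltW My).
- apply: measurable_bounded_integrable => //.
  exists `|m|; split; first exact: num_real.
  by move=> y My x _; exact: ltW.
move=> phi mphi phioo; have iphi := Linfty_integrable mphi phioo.
have H := cvg_integral_oscillating mA A0 AM (cell_periodic_area b_per) iphi.
(* The cut-off to [W] is moved onto the test function, leaving the oscillating factor defined on the
   whole cube. *)
have mul_patch (h : 'rV[R]_n -> R) :
    ((fun x => h x * phi x) \_ W) = (fun x => (phi \_ W) x * h x).
  by apply/funext => x; rewrite !patchE; case: ifP => _; rewrite ?mul0r// mulrC.
have -> : (\int[mu]_(x in W) (m * phi x)%:E)%E =
    (\int[mu]_(x in cube K) (phi \_ W) x * m)%:E.
  rewrite integral_restrict_cube mul_patch -RintegralZr// /Rintegral fineK//.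
  apply: integrable_fin_num => //; have := integrableZr mK m iphi; exact.
have H' : (\int[mu]_(x in cube K) ((phi \_ W) x * A (e^-1 *: x)))%:E
    @[e --> 0^'+] --> (\int[mu]_(x in cube K) (phi \_ W) x * m)%:E.
  by apply: cvg_EFin; [exact: nearW|exact: H].
(* The area density is a dilation of that of [b] only for [e > 0], so the two families are
   identified near [0^'+]. *)
apply: cvg_trans H'.
apply: near_eq_cvg; near=> e; have e0 : 0 < e by near: e; exact: nbhs_right_gt.
rewrite /= integral_restrict_cube mul_patch.
under [RHS]eq_integral do rewrite area_density_oscillating1//.
rewrite /Rintegral fineK//; apply: integrable_fin_num => //.
exact: (@integrable_mul_bounded _ _ R mu (cube K) R _ M mK (mAD (cube K)) AN
  (phi \_ W) e iphi).
Unshelve. all: by end_near. Qed.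

(** Continuity from above in the unit cell: the sets decrease to the part of the critical set lying
    in the cell, which is null. *)
Lemma cvg_measure_sublevel : mu [set x | eucl_norm (grad b x) = 0] = 0%E ->
  mu ([set x | \sum_k partial k b x ^+ 2 <= i.+1%:R^-1] `&` Y) @[i --> \oo] --> 0%E.
Proof.
move=> b_crit; have [L L0 bL] := lipschitzE b_lip.
have mG := measurable_sqr_grad L0 bL.
pose S (r : R) := [set x | \sum_k partial k b x ^+ 2 <= r].
have mS r : measurable (S r).
  rewrite -[S r]setTI
    (_ : S r = (fun x => \sum_k partial k b x ^+ 2) @^-1` `]-oo, r]%classic).
    by apply: mG => //; exact: measurable_itv.
  by apply/seteqP; split => x; rewrite /S/= in_itv.
have mY := @measurable_unit_cell R n.
have capE : \bigcap_i (S i.+1%:R^-1 `&` Y) = S 0 `&` Y.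
  apply/seteqP; split => x.
    move=> H; split; last by have [] := H 0%N Logic.I.
    rewrite /S/= leNgt; apply/negP => /exists_invS_lt[i]; rewrite ltNge => /negP.
    by apply; have [] := H i Logic.I.
  move=> [Sx Yx] i _; split => //; apply: le_trans Sx _.
  by rewrite invr_ge0.
have S0 : mu (S 0 `&` Y) = 0%E.
  apply/eqP; rewrite eq_le measure_ge0 andbT -b_crit.
  apply: le_measure; rewrite ?inE; [exact: measurableI| |].
    rewrite (_ : [set x | _] = S 0)//.
    apply/seteqP; split => x; rewrite /S /= -sqr_eucl_norm_grad.
      by move=> ->; rewrite expr0n.
    by move=> H; apply/eqP; rewrite -sqrf_eq0 eq_le H sqr_ge0.
  move=> x [Sx _]; rewrite /S /= -sqr_eucl_norm_grad in Sx.
  by apply/eqP; rewrite -sqrf_eq0 eq_le Sx sqr_ge0.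
rewrite -S0 -capE; apply: (@nonincreasing_cvg_mu _ _ _ mu (fun i => S i.+1%:R^-1 `&` Y)).
- apply: (@le_lt_trans _ _ (mu Y)); last by rewrite lebesgue_unit_cell ltry.
  by apply: le_measure; rewrite ?inE//; exact: measurableI.
- by move=> i; exact: measurableI.
- by rewrite capE; exact: measurableI.
- move=> i j ij; apply/subsetPset; apply: setSI => x; rewrite /S/= => H.
  by apply: le_trans H _; rewrite lef_pV2 ?posrE// ler_nat.
Qed.

(** A density at most [t] at [x] forces the squared gradient of [b] at [x/e] below
    [(t e^(1 - alpha))^2], which tends to 0. Averaging the periodic indicator of a sublevel set
    bounds the measure by [mu B] times that of the sublevel set in one cell. *)
Lemma cvg_measure_area_density alpha t : 0 < alpha < 1 -> 0 < t ->
  mu [set x | eucl_norm (grad b x) = 0] = 0%E ->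
  mu [set x | W x /\ area_density (oscillating alpha b e) x <= t]
    @[e --> 0^'+] --> 0%E.
Proof.
move=> /andP[alpha0 alpha1] t0 b_crit; have [L L0 bL] := lipschitzE b_lip.
pose G x := \sum_k partial k b x ^+ 2.
have mG : measurable_fun setT G := measurable_sqr_grad L0 bL.
pose S (r : R) := [set x | G x <= r].
have mS r : measurable (S r).
  rewrite -[S r]setTI (_ : S r = G @^-1` `]-oo, r]%classic).
    by apply: mG => //; exact: measurable_itv.
  by apply/seteqP; split => x; rewrite /S/= in_itv.
have mY := @measurable_unit_cell R n.
(* For [e <= 1] this cube contains every translate of [cube K] by [- e s] with [s] in the unit
   cell. *)
pose B : set 'rV[R]_n := cube (K + 1).
have mB : measurable B by exact: measurable_open_box.
have Boo : (mu B < +oo)%E by exact: open_box_fin.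
pose V e := [set x | W x /\ area_density (oscillating alpha b e) x <= t].
have mV (e : R) : 0 < e -> measurable (V e).
  move=> e0.
  have [L' L'0 gL] := oscillating_lipschitz alpha b_lip.
  have mA := measurable_area_density
    (mulr_ge0 (powR_ge0 e (alpha - 1)) L'0) (gL e e0).
  rewrite (_ : V e =
    W `&` (area_density (oscillating alpha b e) @^-1` `]-oo, t]%classic)).
    by apply: measurableI => //; rewrite -[X in measurable X]setTI; exact: mA.
  by apply/seteqP; split => x /=; rewrite in_itv.
have bound (i : nat) (e : R) : 0 < e -> e <= 1 ->
    (t * e `^ (1 - alpha)) ^+ 2 <= i.+1%:R^-1 ->
    (mu (V e) <= mu B * mu (S (i.+1%:R^-1)%R `&` Y))%E.
  move=> e0 e1 ti; set r := i.+1%:R^-1 in ti *.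
  have p0 : 0 < e `^ (1 - alpha) by rewrite powR_gt0.
  have sub : V e `<=` cube K `&` [set x | S r (e^-1 *: x)].
    move=> x [Wx]; rewrite area_density_oscillating// => xt; split; first exact: WK.
    rewrite /S /=; apply: le_trans ti.
    (* Square the bound, drop the summand 1, and use that [e^(alpha - 1)] is the inverse of
       [e^(1 - alpha)]. *)
    have : (Num.sqrt (1 + (e `^ (alpha - 1)) ^+ 2 * G (e^-1 *: x))) ^+ 2 <= t ^+ 2.
      by rewrite ler_sqr ?nnegrE ?sqrtr_ge0 ?(ltW t0).
    rewrite sqr_sqrtr.
      rewrite -(opprB 1 alpha) powRN => H.
      rewrite exprMn -ler_pdivrMr ?exprn_gt0// mulrC -exprVn.
      by apply: le_trans H; rewrite lerDr.
    by rewrite addr_ge0// mulr_ge0 ?sqr_ge0// sumr_ge0// => k _; exact: sqr_ge0.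
  have mSe : measurable [set x | S r (e^-1 *: x)].
    by rewrite -[X in measurable X]setTI; exact: (measurable_rV_scale _).
  have mVe := mV e e0.
  apply: (@le_trans _ _ (mu (cube K `&` [set x | S r (e^-1 *: x)]))).
    by apply: le_measure; rewrite ?inE//; exact: measurableI.
  pose I (x : 'rV[R]_n) : \bar R := (\1_(S r) x)%:E.
  have mI : measurable_fun setT I by exact/measurable_EFinP.
  have I0 x : (0 <= I x)%E by rewrite lee_fin.
  have Iper k x : I (x + delta_mx ord0 k) = I x.
    rewrite /I !indicE (_ : (_ \in _) = (x \in S r))//.
    have -> : (x + delta_mx ord0 k \in S r) = (G (x + delta_mx ord0 k) <= r).
      by apply/idP/idP; rewrite inE.
    have -> : (x \in S r) = (G x <= r) by apply/idP/idP; rewrite inE.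
    congr (_ <= _); apply: eq_bigr => j _; congr (_ ^+ 2).
    exact: cell_periodic_partial.
  have en0 : e != 0 by rewrite gt_eqF.
  have E1 : (\int[mu]_(x in cube K) I (e^-1 *: x)%R =
      mu (cube K `&` [set x | S r (e^-1 *: x)]))%E.
    by rewrite setIC -integral_indic.
  have E2 : (\int[mu]_(x in Y) I x = mu (S r `&` Y))%E by rewrite -integral_indic.
  rewrite -E1 -E2; apply: (integral_dilated_le mI I0 Iper en0 mK mB) => s x Ys Bx j.
  move: (Bx j) (Ys j); rewrite !mxE => /andP[? ?] /andP[? ?].
  by apply/andP; split; nra.
have Vmono (e : R) : 0 < e -> (mu (V e) <= mu W)%E.
  by move=> e0; apply: le_measure; rewrite ?inE; [exact: mV|by []|move=> x []].
have /fine_cvgP[Sfin /cvgrPdist_le Scvg] := cvg_measure_sublevel b_crit.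
have BE : mu B = (fine (mu B))%:E by rewrite fineK// ge0_fin_numE.
apply/fine_cvgP; split.
  near=> e; have e0 : 0 < e by near: e; exact: nbhs_right_gt.
  by rewrite ge0_fin_numE// (le_lt_trans (Vmono e e0)).
apply/cvgrPdist_le => eta eta0; set beta := fine (mu B) in BE.
have beta0 : 0 <= beta by exact: fine_ge0.
(* [beta] is the measure of the larger cube; adding 1 to it avoids a zero divisor. The index [i] is
   fixed before [e] is made small. *)
have [i _ iP] := Scvg (eta / (beta + 1)) (divr_gt0 eta0 (ltr_wpDl beta0 ltr01)).
have {iP} := iP i (leqnn i).
rewrite /= sub0r normrN; set si := fine _ => si_le.
have Ei : mu (S i.+1%:R^-1 `&` Y) = si%:E.
  rewrite /si fineK// ge0_fin_numE//.
  apply: (@le_lt_trans _ _ (mu Y)); last by rewrite lebesgue_unit_cell ltry.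
  apply: le_measure; rewrite ?inE; [|exact: mY|by move=> x []].
  exact: (measurableI _ _ (mS _) mY).
have p_cvg : (t * e `^ (1 - alpha)) ^+ 2 @[e --> 0^'+] --> 0.
  have : t * e `^ (1 - alpha) @[e --> 0^'+] --> t * 0.
    by apply: cvgMr; apply: powR_cvg0; rewrite subr_gt0.
  rewrite mulr0 => h; rewrite -[X in _ --> X](mulr0 (0 : R)).
  by under eq_fun do rewrite expr2; exact: cvgM.
near=> e; have e0 : 0 < e by near: e; exact: nbhs_right_gt.
have e1 : e <= 1 by near: e; apply: nbhs_right_le; exact: ltr01.
have te : (t * e `^ (1 - alpha)) ^+ 2 <= i.+1%:R^-1.
  near: e; apply: (cvgr_le 0) => //.
have := bound i e e0 e1 te; rewrite BE Ei -EFinM => V_le.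
rewrite sub0r normrN ger0_norm ?fine_ge0//.
have Vfin : mu (V e) = (fine (mu (V e)))%:E.
  by rewrite fineK// ge0_fin_numE// (le_lt_trans (Vmono e e0)).
rewrite -/(V e); move: V_le; rewrite Vfin lee_fin => /le_trans; apply.
move: si_le; rewrite ler_pdivlMr ?ltr_wpDl//.
have : 0 <= si by exact: fine_ge0.
rewrite ger0_norm ?fine_ge0//; nra.
Unshelve. all: by end_near.
Qed.

End oscillating_area.

(** * Hausdorff measure under Lipschitz maps *)

Lemma lee_expe (R : realDomainType) (x y : \bar R) s :
  (0 <= x)%E -> (x <= y)%E -> (x ^+ s <= y ^+ s)%E.
Proof.
move=> x0 xy; elim: s => [|s IH]; first by rewrite !expe0.
by rewrite !expeS lee_pmul// expe_ge0.
Qed.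

Lemma expeMl (R : realDomainType) (c : R) (x : \bar R) s :
  ((c%:E * x) ^+ s = (c ^+ s)%:E * x ^+ s)%E.
Proof.
elim: s => [|s IH]; first by rewrite !expe0 mule1.
by rewrite !expeS IH exprS EFinM muleACA.
Qed.

Section hausdorff_lipschitz.
Context {R : realType} {p q : nat}.
Local Open Scope ereal_scope.
Implicit Types (s : nat) (F : set 'rV[R]_p).

Lemma diameter_ge0 (r : nat) (A : set 'rV[R]_r) : 0 <= diameter A.
Proof. by apply: ereal_sup_ubound; left. Qed.

Lemma eucl_dist_le_diameter (r : nat) (A : set 'rV[R]_r) x y :
  A x -> A y -> (eucl_norm (x - y)%R)%:E <= diameter A.
Proof. by move=> Ax Ay; apply: ereal_sup_ubound; right; exists x => //; exists y. Qed.

Variables (f : 'rV[R]_p -> 'rV[R]_q) (A : set 'rV[R]_p) (c : R).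
Hypothesis c0 : (0 < c)%R.
Hypothesis fc : forall x y, A x -> A y ->
  (eucl_norm (f x - f y) <= c * eucl_norm (x - y))%R.

Lemma diameter_image F : diameter (f @` (F `&` A)) <= c%:E * diameter F.
Proof.
apply: ge_ereal_sup => _ [->|[_ [x [Fx Ax] <-] [_ [y [Fy Ay] <-] <-]]].
  by rewrite mule_ge0 ?diameter_ge0// lee_fin ltW.
apply: (@le_trans _ _ (c%:E * (eucl_norm (x - y)%R)%:E)).
  by rewrite -EFinM lee_fin fc.
by rewrite lee_pmul2l// eucl_dist_le_diameter.
Qed.

(** A cover of [A] at scale [d] is mapped to a cover of the image at scale [c d]. The pieces are
    first cut down to [A], the only set on which [f] is assumed Lipschitz. *)
Lemma hausdorff_pre_image s d : (0 < d)%R ->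
  hausdorff_pre s (c * d) (f @` A) <= (c ^+ s)%:E * hausdorff_pre s d A.
Proof.
move=> d0; have cs : (0 < c ^+ s)%R by rewrite exprn_gt0.
rewrite -lee_pdivrMl//; apply: le_ereal_inf_tmp => _ [F [AF Fd] <-].
rewrite lee_pdivrMl//.
set V := lebesgue_rV R s _; have V0 : 0 <= V by exact: measure_ge0.
apply: (@le_trans _ _
  (\sum_(k <oo) V * (2^-1%:E * diameter (f @` (F k `&` A))) ^+ s)).
  apply: ereal_inf_lbound; exists (fun k => f @` (F k `&` A)) => //; split.
    move=> _ [x Ax <-]; have [k _ Fkx] := AF _ Ax.
    by exists k => //; exists x.
  move=> k; rewrite EFinM; apply: le_trans (diameter_image _) _.
  by rewrite lee_pmul2l.
have h0 : 0 <= (2^-1 : R)%:E by rewrite lee_fin invr_ge0.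
rewrite -nneseriesZl; last first.
  by move=> k _; rewrite mule_ge0// expe_ge0// mule_ge0// diameter_ge0.
apply: lee_nneseries => [k _ _|k _].
  by rewrite mule_ge0// expe_ge0// mule_ge0// diameter_ge0.
rewrite muleCA; apply: lee_pmul => //.
  by rewrite expe_ge0// mule_ge0// diameter_ge0.
rewrite -expeMl; apply: lee_expe; first by rewrite mule_ge0// diameter_ge0.
by rewrite muleCA lee_pmul2l ?diameter_image// lte_fin invr_gt0.
Qed.

Lemma hausdorff_image s : hausdorff s (f @` A) <= (c ^+ s)%:E * hausdorff s A.
Proof.
apply: ge_ereal_sup => _ [d /= d0 <-].
have dc : (0 < d / c)%R by rewrite divr_gt0.
rewrite -(mulfVK (lt0r_neq0 c0) d) mulrC.
apply: le_trans (hausdorff_pre_image _ dc) _.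
rewrite lee_pmul2l ?lte_fin ?exprn_gt0//.
by apply: ereal_sup_ubound; exists (d / c)%R.
Qed.

End hausdorff_lipschitz.

Lemma hausdorff_subset (R : realType) p s (A B : set 'rV[R]_p) :
  A `<=` B -> (hausdorff s A <= hausdorff s B)%E.
Proof.
move=> AB; apply: ge_ereal_sup => _ [d /= d0 <-].
apply: (@le_trans _ _ (hausdorff_pre s d B)); last first.
  by apply: ereal_sup_ubound; exists d.
apply: ereal_inf_le_tmp => _ [F [BF Fd] <-]; exists F => //; split => //.
exact: subset_trans BF.
Qed.

(** Applied to a vertical stretching and to its inverse, this transports boundaries both ways. *)
Lemma boundary_preimage (T U : topologicalType) (f : T -> U) (A : set U) :
  continuous f -> boundary (f @^-1` A) `<=` f @^-1` (boundary A).
Proof.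
move=> cf x [clx nintx]; split.
  move=> B /cf fB; have [y [Ay By]] := clx _ fB; by exists (f y).
by move=> /cf intx; apply: nintx.
Qed.

(** * Vertical stretching of subgraphs *)

Lemma continuous_rV (R : realType) p (T : topologicalType) (f : T -> 'rV[R]_p) :
  (forall i, continuous (fun x => f x ord0 i)) -> continuous f.
Proof.
move=> cf x A /= /nbhs_coord_ball[e e0 eA]; rewrite /nbhs/=.
have : \forall y \near x, forall i, `|f x ord0 i - f y ord0 i| < e.
  by apply: filter_forall => i; have /cvgrPdist_lt := cf i x; apply.
by apply: filterS => y H; exact: eA.
Qed.

Section vertical_stretch.
Context {R : realType} {n : nat}.
Implicit Types (g : 'rV[R]_n -> R) (x y : 'rV[R]_(n + 1)).

Definition height x : R := rsubmx x ord0 ord0.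

Definition vmap (h : 'rV[R]_(n + 1) -> R) x : 'rV[R]_(n + 1) :=
  row_mx (lsubmx x) (const_mx (h x)).

Lemma lsubmx_vmap h x : lsubmx (vmap h x) = lsubmx x.
Proof. exact: row_mxKl. Qed.

Lemma height_vmap h x : height (vmap h x) = h x.
Proof. by rewrite /height row_mxKr mxE. Qed.

Lemma vmap_eta x y : lsubmx x = lsubmx y -> height x = height y -> x = y.
Proof.
move=> xy hxy; rewrite -(hsubmxK x) -(hsubmxK y) xy; congr row_mx.
by apply/rowP => i; rewrite (ord1 i).
Qed.

Lemma continuous_height : continuous height.
Proof.
have -> : height = (fun x => x ord0 (rshift n ord0)).
  by apply/funext => x; rewrite /height mxE.
exact: coord_continuous.
Qed.

Lemma continuous_vmap h : continuous h -> continuous (vmap h).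
Proof.
move=> ch; apply: continuous_rV => i; case: (split_ordP i) => j ->.
  have -> : (fun x => vmap h x ord0 (lshift 1 j)) = (fun x => x ord0 (lshift 1 j)).
    by apply/funext => x; rewrite row_mxEl mxE.
  exact: coord_continuous.
have -> : (fun x => vmap h x ord0 (rshift n j)) = h.
  by apply/funext => x; rewrite row_mxEr mxE.
exact: ch.
Qed.

Lemma sqr_eucl_norm_height x :
  eucl_norm x ^+ 2 = \sum_i lsubmx x ord0 i ^+ 2 + height x ^+ 2.
Proof.
rewrite sqr_eucl_norm big_split_ord big_ord1/= /height mxE; congr (_ + _).
by apply: eq_bigr => i _; rewrite mxE.
Qed.

Definition stretch g := vmap (fun x => height x + (1 + height x) * g (lsubmx x)).
(** Obtained by solving [t + (1 + t) g = s] for [t]; it inverts [stretch g] as long as [1 + g] does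
    not vanish. *)
Definition unstretch g :=
  vmap (fun x => (height x - g (lsubmx x)) / (1 + g (lsubmx x))).

Section one_profile.
Variables (g : 'rV[R]_n -> R) (L M : R) (W : set 'rV[R]_n).
Hypothesis L0 : 0 <= L.
Hypothesis gL : forall u v, `|g u - g v| <= L * `|u - v|.
Hypothesis g0 : forall u, 0 <= g u.
Hypothesis gM : forall u, g u <= M.

Let g1 u : 1 + g u != 0.
Proof. by rewrite gt_eqF// ltr_wpDr. Qed.

Lemma lsubmx_norm_le x : `|lsubmx x| <= `|x|.
Proof.
by apply: mx_norm_le => // i; rewrite mxE; exact: mx_norm_coord.
Qed.

Let continuous_base : continuous (fun x => g (lsubmx x)).
Proof.
apply: (lipschitz_continuous_rV L0) => x y; apply: le_trans (gL _ _) _.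
rewrite ler_wpM2l//; have -> : lsubmx x - lsubmx y = lsubmx (x - y).
  by apply/rowP => i; rewrite !mxE.
exact: lsubmx_norm_le.
Qed.

Lemma continuous_stretch : continuous (stretch g).
Proof.
apply: continuous_vmap => x; apply: continuousD; first exact: continuous_height.
apply: continuousM; last exact: continuous_base.
by apply: continuousD; [exact: cst_continuous|exact: continuous_height].
Qed.

Lemma continuous_unstretch : continuous (unstretch g).
Proof.
apply: continuous_vmap => x.
apply: (@continuousM _ _ (fun x => height x - g (lsubmx x))
  (fun x => (1 + g (lsubmx x))^-1)).
  by apply: continuousB; [exact: continuous_height|exact: continuous_base].
apply: continuousV; first exact: g1.
by apply: continuousD; [exact: cst_continuous|exact: continuous_base].
Qed.

Lemma unstretchK : cancel (unstretch g) (stretch g).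
Proof.
move=> x; apply: vmap_eta; rewrite ?lsubmx_vmap// !height_vmap lsubmx_vmap.
by field; exact: g1.
Qed.

Lemma stretchK : cancel (stretch g) (unstretch g).
Proof.
move=> x; apply: vmap_eta; rewrite ?lsubmx_vmap// !height_vmap lsubmx_vmap.
by field; exact: g1.
Qed.

(** With [s = t + (1 + t) g] one has [s + 1 = (1 + t) (1 + g)] and [s - g = t (1 + g)], so
    [-1 < t < 0] exactly when [-1 < s < g]. *)
Lemma subgraph_stretch :
  subgraph W (fun=> 0) = stretch g @^-1` subgraph W g.
Proof.
apply/seteqP; split=> x; rewrite /subgraph/= lsubmx_vmap -!/(height _) height_vmap;
  move: (g0 (lsubmx x)) => gx [Wx /andP[h1 h2]]; split=> //; apply/andP; split; nra.
Qed.

Lemma subgraph_unstretch :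
  subgraph W g = unstretch g @^-1` subgraph W (fun=> 0).
Proof.
rewrite subgraph_stretch; apply/seteqP; split => x /=; first by rewrite unstretchK.
by rewrite unstretchK.
Qed.

Lemma boundary_subgraph_height x :
  boundary (subgraph W (fun=> 0)) x -> -1 <= height x <= 0.
Proof.
move=> [clx _].
have cS : closed (height @^-1` `[-1, 0]%classic).
  apply: preimage_closed; last exact: interval_closed.
  by move=> y _; exact: continuous_height.
have : closure (height @^-1` `[-1, 0]%classic) x.
  apply: closureS clx => y [_ /andP[h1 h2]].
  by rewrite /= in_itv/=; apply/andP; split; exact: ltW.
by rewrite -((closure_id _).1 cS)/= in_itv.
Qed.

Let delta := M + L.

(** Stretching adds [d] to the height difference [a], so the squared distance becomes
    [r^2 + 2 a d + d^2] with [|a| <= r] and [|d| <= delta r]. Dropping [d^2] gives the lower bound,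
    completing the square the upper one. *)
Lemma stretch_dist x y : -1 <= height x <= 0 -> -1 <= height y <= 0 ->
  (1 - 2 * delta) * eucl_norm (x - y) ^+ 2 <=
    eucl_norm (stretch g x - stretch g y) ^+ 2 <=
    ((1 + delta) * eucl_norm (x - y)) ^+ 2.
Proof.
move=> hx hy; set r := eucl_norm (x - y); have r0 : 0 <= r := eucl_norm_ge0 _.
have lB u v : lsubmx (u - v) = lsubmx u - lsubmx v :> 'rV[R]_n.
  by apply/rowP => i; rewrite !mxE.
have hB u v : height (u - v) = height u - height v by rewrite /height !mxE.
have := sqr_eucl_norm_height (x - y); rewrite -/r lB hB.
rewrite sqr_eucl_norm_height lB hB !lsubmx_vmap !height_vmap.
set s := \sum_i _; have s0 : 0 <= s by apply: sumr_ge0 => i _; exact: sqr_ge0.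
set a := height x - height y => rE.
set d := (1 + height x) * g (lsubmx x) - (1 + height y) * g (lsubmx y).
have -> : height x + (1 + height x) * g (lsubmx x) -
    (height y + (1 + height y) * g (lsubmx y)) = a + d by rewrite /a /d; ring.
have ar : `|a| <= r.
  by rewrite -(@ler_sqr _ `|a| r) ?nnegrE// real_normK ?num_real// rE lerDr.
(* [gL] uses the sup norm, which is dominated by the Euclidean distance [r]. *)
have lr : `|lsubmx x - lsubmx y| <= r.
  apply: mx_norm_le => // i.
  rewrite -(@ler_sqr _ _ r) ?nnegrE// real_normK ?num_real// rE.
  apply: (@le_trans _ _ s); last by rewrite lerDl sqr_ge0.
  rewrite /s (bigD1 i)//= lerDl; apply: sumr_ge0 => j _; exact: sqr_ge0.
(* One part of [d] is [a] times a value of [g], bounded by [M r]; the other is an increment of [g]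
   times [1 + height y], which lies in [[0, 1]], bounded by [L r]. *)
have dr : `|d| <= delta * r.
  have -> : d = a * g (lsubmx x) + (1 + height y) * (g (lsubmx x) - g (lsubmx y)).
    by rewrite /d /a; ring.
  rewrite (le_trans (ler_normD _ _))// /delta [leRHS]mulrDl lerD// normrM.
    by rewrite mulrC ler_pM// ger0_norm.
  rewrite -[leRHS]mul1r ler_pM//; last first.
    by rewrite (le_trans (gL _ _))// ler_wpM2l.
  by rewrite ler_norml; apply/andP; split; lra.
have d0 : 0 <= delta.
  by rewrite /delta addr_ge0// (le_trans (g0 0)).
have ad : `|a * d| <= delta * r ^+ 2.
  by rewrite normrM expr2 mulrCA ler_pM.
move: ad; rewrite ler_norml => /andP[ad1 ad2].
have dd : d ^+ 2 <= (delta * r) ^+ 2.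
  by rewrite -real_normK ?num_real// ler_sqr ?nnegrE// mulr_ge0.
have -> : s + (a + d) ^+ 2 = r ^+ 2 + 2 * (a * d) + d ^+ 2 by rewrite rE; ring.
have := sqr_ge0 d => d20; apply/andP; split; first by lra.
rewrite exprMn in dd; have -> : ((1 + delta) * r) ^+ 2 =
  r ^+ 2 + 2 * (delta * r ^+ 2) + delta ^+ 2 * r ^+ 2 by ring.
by lra.
Qed.

Lemma stretch_lipschitz x y : -1 <= height x <= 0 -> -1 <= height y <= 0 ->
  eucl_norm (stretch g x - stretch g y) <= (1 + delta) * eucl_norm (x - y).
Proof.
move=> hx hy; have /andP[_] := stretch_dist hx hy.
rewrite ler_sqr ?nnegrE ?eucl_norm_ge0// mulr_ge0 ?eucl_norm_ge0//.
by rewrite /delta !addr_ge0// (le_trans (g0 0)).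
Qed.

(** As [1 - 2 delta] lies in [(0, 1]], its square is no larger than itself, which gives a constant
    free of square roots. *)
Lemma unstretch_lipschitz x y : 2 * delta < 1 ->
  -1 <= height x <= 0 -> -1 <= height y <= 0 ->
  eucl_norm (x - y) <= (1 - 2 * delta)^-1 * eucl_norm (stretch g x - stretch g y).
Proof.
move=> d1 hx hy; have d0 : 0 <= delta.
  by rewrite /delta addr_ge0// (le_trans (g0 0)).
rewrite ler_pdivlMl ?subr_gt0// -ler_sqr ?nnegrE ?mulr_ge0 ?eucl_norm_ge0//;
  last by lra.
have /andP[+ _] := stretch_dist hx hy; apply: le_trans.
rewrite exprMn ler_wpM2r ?sqr_ge0// expr2 ler_piMl//; lra.
Qed.

Lemma perimeter_subgraph_le :
  (perimeter (subgraph W g) <=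
   ((1 + delta) ^+ n)%:E * perimeter (subgraph W (fun=> 0%R)))%E.
Proof.
have d0 : 0 < 1 + delta.
  by rewrite ltr_wpDr// /delta addr_ge0// (le_trans (g0 0)).
set A := boundary (subgraph W (fun=> 0)).
have BA : boundary (subgraph W g) `<=` stretch g @` A.
  move=> x; rewrite {1}subgraph_unstretch.
  move=> /(boundary_preimage continuous_unstretch) Ax.
  by exists (unstretch g x) => //; rewrite unstretchK.
apply: le_trans (hausdorff_subset _ BA) _; apply: hausdorff_image => // x y Ax Ay.
by apply: stretch_lipschitz; exact: boundary_subgraph_height.
Qed.

Lemma perimeter_subgraph_ge : 2 * delta < 1 ->
  (((1 - 2 * delta) ^+ n)%:E * perimeter (subgraph W (fun=> 0%R)) <=
   perimeter (subgraph W g))%E.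
Proof.
move=> d1; have d2 : 0 < 1 - 2 * delta by lra.
rewrite -lee_pdivlMl ?exprn_gt0// -exprVn.
set A := boundary (subgraph W g).
have BA : boundary (subgraph W (fun=> 0)) `<=` unstretch g @` A.
  move=> x; rewrite {1}subgraph_stretch.
  move=> /(boundary_preimage continuous_stretch) Ax.
  by exists (stretch g x) => //; rewrite stretchK.
apply: le_trans (hausdorff_subset _ BA) _.
apply: hausdorff_image; first by rewrite invr_gt0.
(* The distance bounds hold only for heights in [[-1, 0]], so points of [A] are compared through
   their unstretched images. *)
have hA x : A x -> -1 <= height (unstretch g x) <= 0.
  rewrite /A subgraph_unstretch => /(boundary_preimage continuous_unstretch).
  exact: boundary_subgraph_height.
move=> x y Ax Ay; have := unstretch_lipschitz d1 (hA _ Ax) (hA _ Ay).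
by rewrite !unstretchK.
Qed.

End one_profile.
End vertical_stretch.

(** * Conclusion *)

(** Covers [H = +oo] too: the factors tend to 1, so the product of the limits is never of the form
    zero times infinity. *)
Lemma mule_cvg1 (R : realType) (I : Type) (F : set_system I) (c : I -> R)
    (H : \bar R) : Filter F -> c i @[i --> F] --> (1 : R) ->
  ((c i)%:E * H)%E @[i --> F] --> H.
Proof.
move=> FF c1; rewrite -[X in _ --> X]mul1e; apply: cvgeM.
- by case: H => //=; rewrite oner_eq0.
- by apply: cvg_EFin => //; exact: nearW.
- exact: cvg_cst.
Qed.

Lemma cvg_perimeter_oscillating (R : realType) (n : nat) (W : set 'rV[R]_n)
    (b : 'rV[R]_n -> R) (alpha : R) : lipschitz b -> cell_periodic b ->
  (forall x, 0 <= b x) -> 1 < alpha ->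
  perimeter (subgraph W (oscillating alpha b e)) @[e --> 0^'+] -->
    perimeter (subgraph W (fun=> 0)).
Proof.
move=> b_lip b_per b_ge0 alpha1.
have [L L0 gL] := oscillating_lipschitz alpha b_lip.
have [M M0 gM] := oscillating_bounded alpha b_lip b_per.
(* A bound on the oscillating profile plus its Lipschitz constant; both exponents are positive
   because [alpha > 1]. *)
pose delta (e : R) := e `^ alpha * M + e `^ (alpha - 1) * L.
have delta0 : delta e @[e --> 0^'+] --> 0.
  have zE : 0 = 0 * M + 0 * L by rewrite !mul0r addr0.
  rewrite [X in _ --> X]zE; apply: cvgD; apply: cvgMl; apply: powR_cvg0.
    exact: lt_trans alpha1.
  by rewrite subr_gt0.
set H := perimeter (subgraph W (fun=> 0)).
have pow_cvg (c : R -> R) m : c e @[e --> 0^'+] --> (1 : R) ->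
    (c e) ^+ m @[e --> 0^'+] --> (1 : R).
  move=> c1; elim: m => [|k IH]; first exact: cvg_cst.
  rewrite -[X in _ --> X](mulr1 (1 : R)).
  by under eq_fun do rewrite exprS; exact: cvgM.
apply: (@squeeze_cvge _ _ _ _ (fun e => ((1 - 2 * delta e) ^+ n)%:E * H)%E _
    (fun e => ((1 + delta e) ^+ n)%:E * H)%E).
- have h2 : 0 < 2^-1 :> R by rewrite invr_gt0.
  near=> e; have e0 : 0 < e by near: e; exact: nbhs_right_gt.
  have d1 : 2 * delta e < 1.
    suff : delta e < 2^-1 by lra.
    by near: e; exact: (cvgr_lt 0 delta0 _ h2).
  have p0 : 0 <= e `^ (alpha - 1) * L by rewrite mulr_ge0// powR_ge0.
  have ge0 u : 0 <= oscillating alpha b e u by rewrite mulr_ge0// powR_ge0.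
  have geM u : oscillating alpha b e u <= e `^ alpha * M.
    exact: le_trans (ler_norm _) (gM e u).
  apply/andP; split.
    exact: (perimeter_subgraph_ge W p0 (gL e e0) ge0 geM d1).
  exact: (perimeter_subgraph_le W p0 (gL e e0) ge0 geM).
- apply: mule_cvg1; apply: pow_cvg.
  have two_delta : 2 * delta e @[e --> 0^'+] --> (2 * 0 : R) by exact: cvgMr.
  have zE : 1 = 1 - 2 * 0 :> R by rewrite mulr0 subr0.
  by rewrite [X in _ --> X]zE; apply: cvgB; [exact: cvg_cst|].
- apply: mule_cvg1; apply: pow_cvg.
  by rewrite -[X in _ --> X]addr0; apply: cvgD; [exact: cvg_cst|].
Unshelve. all: by end_near. Qed.

(** Extracts from either kind of domain the two facts on which the averaging arguments rely. *)
Lemma bounded_measurable_domain (R : realType) n (W : set 'rV[R]_n) :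
  cuboid W \/ lipschitz_domain W -> measurable W /\ exists K, W `<=` cube K.
Proof.
case=> [[a [c [_ ->]]]|[oW _ _ [M [_ WM]] _]].
  split; first exact: measurable_open_box.
  exists (`|a| + `|c|) => x xac i; rewrite !mxE.
  have /andP[ax xc] := xac i; have := mx_norm_coord a i; have := mx_norm_coord c i.
  rewrite !ler_norml => /andP[? ?] /andP[? ?].
  have := normr_ge0 a; have := normr_ge0 c => ? ?.
  by apply/andP; split; lra.
split; first exact: open_measurable_rV.
(* Boundedness gives [|x| <= k] for every [k > M]; take [k = |M| + 1], and one more unit makes the
   inequality strict. *)
exists (`|M| + 2) => x Wx i; rewrite !mxE -ltr_norml.
have M1 : M < `|M| + 1 by rewrite (le_lt_trans (ler_norm _))// ltrDl.
apply: (le_lt_trans (mx_norm_coord x i)); apply: (le_lt_trans (WM _ M1 x Wx)).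
by rewrite ltrD2l; lra.
Qed.

(* n is N - 1. *)
Theorem proposition3p4 (R : realType) (n : nat) (hn : (0 < n)%N)
    (W : set 'rV[R]_n) (hW : cuboid W \/ lipschitz_domain W)
    (b : 'rV[R]_n -> R) (b_lip : lipschitz b) (b_per : cell_periodic b)
    (b_ge0 : forall x, 0 <= b x)
    (b_crit : lebesgue_rV R n [set x | eucl_norm (grad b x) = 0] = 0%E)
    (alpha : R) :
  let g := oscillating alpha b in
  [/\ 1 < alpha ->
        [/\ Linfty_norm W (g e) @[e --> 0^'+] --> 0%E,
            forall k : 'I_n, exists C : R,
              \forall e \near 0^'+, (Linfty_norm W (partial k (g e)) <= C%:E)%E &
            perimeter (subgraph W (g e)) @[e --> 0^'+] -->
              perimeter (subgraph W (fun=> 0))],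
      alpha = 1 ->
        [/\ Linfty_norm W (g e) @[e --> 0^'+] --> 0%E,
            forall k : 'I_n, exists C : R,
              \forall e \near 0^'+, (Linfty_norm W (partial k (g e)) <= C%:E)%E &
            L1_weak_cvg W (fun e => area_density (g e))
              (fun=> \int[lebesgue_rV R n]_(y in unit_cell R n)
                       area_density b y)] &
      0 < alpha < 1 ->
        Linfty_norm W (g e) @[e --> 0^'+] --> 0%E /\
        forall t : R, 0 < t ->
          lebesgue_rV R n [set x | W x /\ area_density (g e) x <= t]
            @[e --> 0^'+] --> 0%E].

Proof.
have [mW [K WK]] := bounded_measurable_domain hW; split.
- move=> alpha1; split.
  + by apply: cvg_Linfty_oscillating => //; exact: lt_trans alpha1.
  + by move=> k; apply: Linfty_partial_oscillating => //; exact: ltW.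
  + exact: cvg_perimeter_oscillating.
- move=> ->; split.
  + exact: cvg_Linfty_oscillating.
  + by move=> k; apply: Linfty_partial_oscillating.
  + exact: (L1_weak_cvg_area b_lip b_per mW WK).
- move=> alpha01; split.
    by apply: cvg_Linfty_oscillating => //; case/andP: alpha01.
  by move=> t t0; exact: (cvg_measure_area_density b_lip b_per mW WK).
Qed.
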